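(* Let $n\in\mathbb{N}$, $0<T<\infty$, and let $u,v:\mathbb{R}^n \times [0,T] \to \mathbb{R}$ be smooth solutions of the biharmonic heat flow $\frac{\partial}{\partial t} w = -\Delta^2 w$ on $\mathbb{R}^n\times[0,T]$ which satisfy $$|\Delta v|^2(x,t) + |\Delta u|^2(x,t) \leq \frac{k_0}{t}$$ for some $k_0 \in \mathbb{R}$, for all $t \in [0,T]$ and all $x \in \mathbb{R}^n$, and $$u(\cdot,0) = v(\cdot,0).$$ Then $u \equiv v$ on $\mathbb{R}^n\times[0,T]$.
   Context: $\Delta$ is the spatial Laplacian, $\Delta^2=\Delta\Delta$. ''Smooth'' on $\mathbb{R}^n\times[0,T]$ means smooth in space and time up to and including $t=0$. The bound with right-hand side $k_0/t$ is understood after multiplying by $t$ (so it is no restriction at $t=0$). *)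

(* Defs.v *)
From mathcomp Require Import all_boot all_order all_algebra.
From mathcomp Require Import all_classical all_reals all_analysis.
Import Order.TTheory GRing.Theory Num.Theory.
Import numFieldNormedType.Exports.

Set Implicit Arguments.
Unset Strict Implicit.
Unset Printing Implicit Defensive.

Local Open Scope classical_set_scope.
Local Open Scope ring_scope.

(* A function on R^n x [0,T] is represented by a total f : 'rV[R]_n -> R -> R;
   nothing below reads the values f x t with t outside [0,T] when it is
   evaluated at times in [0,T]. *)

Section BiharmonicHeatFlow.
Variables (R : realType) (n : nat).
Implicit Types (T : R) (g : 'rV[R]_n -> R) (f : 'rV[R]_n -> R -> R).

Definition basis_vec (i : 'I_n) : 'rV[R]_n := delta_mx 0 i.

Definition laplacian g : 'rV[R]_n -> R :=
  fun x => \sum_(i < n) 'D_(basis_vec i) ('D_(basis_vec i) g) x.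

Definition bilaplacian g : 'rV[R]_n -> R := laplacian (laplacian g).

Definition dspace (i : 'I_n) f : 'rV[R]_n -> R -> R :=
  fun x t => 'D_(basis_vec i) (f^~ t) x.

Definition time_quotient f (x : 'rV[R]_n) (t : R) : R -> R :=
  fun s => (s - t)^-1 * (f x s - f x t).

(* s tends to t within [0,T], s <> t: two-sided for 0 < t < T and one-sided at
   the end points. *)
Definition time_filter T (t : R) : set_system R := within `[0, T] t^'.

Definition dtime_exists T f (x : 'rV[R]_n) (t : R) : Prop :=
  cvg (time_quotient f x t @ time_filter T t).

Definition dtime T f : 'rV[R]_n -> R -> R :=
  fun x t => lim (time_quotient f x t @ time_filter T t).

Definition slab T : set ('rV[R]_n * R) := [set p | 0 <= p.2 <= T].

(* Iterated partial derivatives in all variables, in any order, up to total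
   order k exist and are continuous on R^n x [0,T], including t = 0 and
   t = T. *)
Fixpoint Ck_slab T (k : nat) f : Prop :=
  {within slab T, continuous (fun p : 'rV[R]_n * R => f p.1 p.2)} /\
  match k with
  | 0%N => True
  | k'.+1 =>
    (forall i : 'I_n,
       (forall x t, 0 <= t <= T -> derivable (f^~ t) x (basis_vec i)) /\
       Ck_slab T k' (dspace i f)) /\
    (forall x t, 0 <= t <= T -> dtime_exists T f x t) /\
    Ck_slab T k' (dtime T f)
  end.

Definition smooth_slab T f : Prop := forall k, Ck_slab T k f.

Definition biharmonic_heat_flow T f : Prop :=
  forall x t, 0 <= t <= T -> dtime T f x t = - bilaplacian (f^~ t) x.

End BiharmonicHeatFlow.

(* Main.v *)
(** Let [w = u - v] and [h = Δw]. Then [h] solves the biharmonic heat flow,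
    [h(.,0) = 0] and [t h^2 <= 2 k0]; once [h = 0] we get [∂_t w = -Δh = 0],
    hence [w = 0].

    To see that [h = 0], fix [x0] and let [p = prod_i (1 - ((x_i - x0_i)/L)^2)] on
    the box [x0 + [-L,L]^n]. Two integrations by parts against [p^m], with the
    lower order terms absorbed by Young's inequality, give for the mean
    [E(t)] of [h^2 p^m] over the box
      [E' <= K L^-4 mean (h^2 p^(m-4))].
    Since [t h^2] is bounded, the right-hand side is at most
    [E/(2t) + C L^-m] when [4 | m] and [m >= 8]. At a maximum [c > 0] of [E(t)/t]
    one has [E'(c) >= E(c)/c], so [E(t) <= 2 C L^-m t]. On the other hand
    [h(x0,t) <> 0] forces [E(t) >= c L^-n], which is impossible for large [L]
    when [m > n].

    Integrals are replaced by averages over a lattice in the box: summation over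
    the lattice kills [∂_i Z] up to an error tending to [0] with the mesh,
    uniformly in time, as soon as [Z] vanishes on the faces [x_i = x0_i ± L]. *)

Require Import Defs.
From mathcomp Require Import all_boot all_order all_algebra.
From mathcomp Require Import all_classical all_reals all_analysis.
From mathcomp Require Import ring lra.
Import Order.TTheory GRing.Theory Num.Theory.
Import numFieldNormedType.Exports.
Local Open Scope classical_set_scope.
Local Open Scope ring_scope.

Set Implicit Arguments.
Unset Strict Implicit.
Unset Printing Implicit Defensive.

(** * Lattice means *)

Section Lines.
Variables (R : realType) (n : nat).
Implicit Types (x v : 'rV[R]_n) (f g : 'rV[R]_n -> R).

Lemma is_derive_line f x v (s df : R) :
  is_derive (x + s *: v) v f df -> is_derive s 1 (fun r => f (x + r *: v)) df.
Proof.
move=> [dv Ddf].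
have E : (fun h : R => h^-1 *: (((fun r => f (x + r *: v)) \o shift s) (h *: 1) - f (x + s *: v)))
   = (fun h : R => h^-1 *: ((f \o shift (x + s *: v)) (h *: v) - f (x + s *: v))).
  apply/funext => h /=; congr (_ *: (f _ - _)).
  by rewrite [h *: 1]mulr1 scalerDl addrCA.
by apply: DeriveDef; [rewrite /derivable E | rewrite /derive E].
Qed.

Lemma mvt_line f g x v (d : R) : 0 <= d ->
  (forall s, 0 <= s <= d -> is_derive (x + s *: v) v f (g (x + s *: v))) ->
  exists2 s, 0 <= s <= d & f (x + d *: v) - f x = d * g (x + s *: v).
Proof.
move=> d0 fg.
have dl s : s \in `[0, d] -> is_derive s 1 (fun r => f (x + r *: v)) (g (x + s *: v)).
  by rewrite in_itv /= => sd; apply: is_derive_line; exact: fg.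
have dl' s : s \in `]0, d[ -> is_derive s 1 (fun r => f (x + r *: v)) (g (x + s *: v)).
  by move=> /subset_itv_oo_cc; exact: dl.
have cf : {within `[0, d], continuous (fun r => f (x + r *: v))}.
  by apply: derivable_within_continuous => s /dl [].
have [c cd E] := MVT_segment d0 dl' cf.
move: cd; rewrite in_itv /= => cd; exists c => //.
by move: E; rewrite scale0r addr0 subr0 mulrC.
Qed.

End Lines.

Section Lattice.
Variables (R : realType) (n : nat) (x0 : 'rV[R]_n) (L T : R).
Hypothesis L0 : 0 < L.

Definition box : set 'rV[R]_n := [set x | forall i, `|x 0 i - x0 0 i| <= L].

Lemma compact_box : compact box.
Proof.
pose B := [set v : 'rV[R]_n | forall i : 'I_n, `[x0 0 i - L, x0 0 i + L]%classic (v ord0 i)].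
have cB : compact B.
  exact: (@rV_compact R n (fun i => `[x0 0 i - L, x0 0 i + L]%classic) (fun i => @segment_compact R _ _)).
suff -> : box = B by [].
apply/seteqP; split=> x bx i; have := bx i; rewrite /= in_itv /= ler_distl.
  by [].
by [].
Qed.

(** Compactness of the box times [[0, T]] makes the modulus [d] independent of both [x] and [t].
    Locally, the points [x] and [x + s *: v] are each within [eps / 2] of the base point's value. *)
Lemma within_slab_unif_line (G : 'rV[R]_n -> R -> R) (v : 'rV[R]_n) (eps : R) :
  {within slab T, continuous (fun p : 'rV[R]_n * R => G p.1 p.2)} -> 0 < eps ->
  exists2 d, 0 < d & forall x t s, 0 <= t <= T -> box x -> box (x + s *: v) ->
    `|s| < d -> `|G x t - G (x + s *: v) t| < eps.
Proof.
move=> /subspace_continuousP cG e0.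
have cpt : compact (box `*` `[0, T]%classic).
  by apply: compact_setX; [exact: compact_box|exact: segment_compact].
pose P (s : R) (p : 'rV[R]_n * R) := box (p.1 + s *: v) ->
  `|G p.1 p.2 - G (p.1 + s *: v) p.2| < eps.
(* Compactness in its near-covering form: it is enough to find, for each base point, a neighbourhood
   of it and a neighbourhood of [s = 0] that work together. *)
have /compact_near_coveringP/near_covering_withinP := cpt.
move=> /(_ R (nbhs (0:R)) P _) [].
  move=> [x t] [/= bx]; rewrite in_itv /= => tT.
  have := cG (x, t) tT => /cvgr_dist_lt/(_ (eps / 2)).
  rewrite divr_gt0// => /(_ isT); rewrite near_withinE => nG0.
  have nG : \forall p \near (x, t), slab T p -> `|G x t - G p.1 p.2| < eps / 2 by exact: nG0.
  have nG2 : \forall p \near (x, t) & s \near (0:R),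
     slab T (p.1 + s *: v, p.2) -> `|G x t - G (p.1 + s *: v) p.2| < eps / 2.
    have c1 : (fun q : ('rV[R]_n * R) * R => q.1.1 + q.2 *: v) @ (nbhs (x,t), nbhs (0:R)) --> x + (0:R) *: v.
      apply: (@cvgD R 'rV[R]_n (('rV[R]_n * R) * R)%type).
        apply: (@cvg_comp _ _ _ fst fst _ (nbhs (x, t))); exact: cvg_fst.
      apply: (@cvgZ R 'rV[R]_n (('rV[R]_n * R) * R)%type); first exact: cvg_snd.
      exact: cvg_cst.
    have c2 : (fun q : ('rV[R]_n * R) * R => q.1.2) @ (nbhs (x,t), nbhs (0:R)) --> t.
      apply: (@cvg_comp _ _ _ fst snd _ (nbhs (x, t))); [exact: cvg_fst|exact: cvg_snd].
    rewrite scale0r addr0 in c1.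
    have cf : (fun q : ('rV[R]_n * R) * R => (q.1.1 + q.2 *: v, q.1.2)) @ (nbhs (x,t), nbhs (0:R)) --> (nbhs x, nbhs t).
      by apply: cvg_pair; [exact: c1|exact: c2].
    exact: (cf _ nG).
  have nG1 : \forall p \near (x, t) & s \near (0:R), slab T p -> `|G x t - G p.1 p.2| < eps / 2.
    exact: (cvg_fst nG).
  apply: filterS2 nG1 nG2 => -[p s] /= G1 G2 [bp pT] bs.
  rewrite in_itv /= in pT; rewrite (splitr eps).
  apply: le_lt_trans (ler_distD (G x t) _ _) _.
  by apply: ltrD; [rewrite distrC; exact: G1 | exact: G2].
move=> d /= d0 Hd; exists d => // x t s tT bx bs sd.
by apply: (Hd s _ (x, t)) => //=; rewrite ?sub0r ?normrN//; split=> //=; rewrite in_itv.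
Qed.

Variable N : nat.

(** The index runs over [0, ..., N - 1] on each axis, so the lattice meets the lower faces of the
    box but not the upper ones. This is what lets the nodes be shifted cyclically. *)
Definition node (k : {ffun 'I_n -> 'I_N}) : 'rV[R]_n :=
  \row_j (x0 0 j - L + 2 * L / N%:R * (k j)%:R).

Definition mean (F : 'rV[R]_n -> R) : R :=
  (N%:R ^+ n)^-1 * \sum_(k : {ffun 'I_n -> 'I_N}) F (node k).

(** [ordS] wraps the last index to 0, so this is a permutation of the indices along which sums can
    be reindexed. *)
Definition shiftf (i : 'I_n) (k : {ffun 'I_n -> 'I_N}) : {ffun 'I_n -> 'I_N} :=
  [ffun j => if j == i then ordS (k j) else k j].

Lemma shiftf_inj i : injective (shiftf i).
Proof.
move=> k l /ffunP E; apply/ffunP => j; have := E j; rewrite !ffunE.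
by case: ifP => // _ /ordS_inj.
Qed.

Hypothesis N0 : (0 < N)%N.

Let N0R : (0 : R) < N%:R. Proof. by rewrite ltr0n. Qed.

Lemma step_coord (k : {ffun 'I_n -> 'I_N}) i (s : R) j :
  (node k + s *: basis_vec R i) 0 j =
  x0 0 j - L + 2 * L / N%:R * (k j)%:R + s * (j == i)%:R.
Proof. by rewrite !mxE eqxx /=. Qed.

Lemma step_box (k : {ffun 'I_n -> 'I_N}) i (s : R) :
  0 <= s <= 2 * L / N%:R -> box (node k + s *: basis_vec R i).
Proof.
move=> /andP[s0 sd] j; rewrite step_coord.
have d0 : 0 <= 2 * L / N%:R by rewrite divr_ge0 ?mulr_ge0 ?ltW.
have kN : ((k j)%:R + 1 : R) <= N%:R by rewrite natr1 ler_nat ltn_ord.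
have Nd : 2 * L / N%:R * N%:R = 2 * L by rewrite divfK // gt_eqF.
have k0 : (0:R) <= (k j)%:R by [].
have sj : 0 <= s * (j == i)%:R <= 2 * L / N%:R.
  by case: (j == i); rewrite ?mulr1 ?mulr0 ?s0 ?lexx.
set d := 2 * L / N%:R in sd d0 Nd sj *.
have : d * ((k j)%:R + 1) <= 2 * L by rewrite -Nd ler_wpM2l.
have : 0 <= d * (k j)%:R by rewrite mulr_ge0.
rewrite mulrDr mulr1 => a0 a1; case/andP: sj => b0 b1.
by rewrite ler_norml; apply/andP; split; lra.
Qed.

Lemma node_box (k : {ffun 'I_n -> 'I_N}) : box (node k).
Proof.
move=> i; have := step_box k i (s := 0); rewrite scale0r addr0; apply.
by rewrite lexx divr_ge0 ?mulr_ge0 ?ltW.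
Qed.

(** One step in direction [i] permutes the nodes, except that the last layer lands on the upper face
    where a cyclic shift would put it on the lower face. [F] vanishes on both faces, so the two sums
    agree. *)
Lemma sum_shift (F : 'rV[R]_n -> R) i :
  (forall x, box x -> `|x 0 i - x0 0 i| = L -> F x = 0) ->
  \sum_k F (node k + 2 * L / N%:R *: basis_vec R i) = \sum_k F (node k).
Proof.
move=> F0; rewrite [RHS](reindex_inj (@shiftf_inj i)); apply: eq_bigr => k _.
have d0 : 0 <= 2 * L / N%:R by rewrite divr_ge0 ?mulr_ge0 ?ltW.
have [kN|kN] := eqVneq ((k i).+1) N.
  rewrite !F0 //; first exact: node_box.
  - rewrite !mxE !ffunE eqxx /= kN modnn mulr0 addr0 addrAC subrr sub0r normrN.
    by rewrite gtr0_norm.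
  - by apply: step_box; rewrite lexx d0.
  have E : 2 * L / N%:R * (k i)%:R + 2 * L / N%:R = 2 * L.
    by rewrite -[X in _ + X]mulr1 -mulrDr natr1 kN divfK ?gt_eqF.
  rewrite step_coord eqxx mulr1 -(addrA (x0 0 i - L)) E.
  have -> : x0 0 i - L + 2 * L - x0 0 i = L by ring.
  by rewrite gtr0_norm.
congr F; apply/rowP => j; rewrite step_coord !mxE !ffunE.
case: eqP => [->|_]; last by rewrite mulr0 addr0.
rewrite mulr1 /= modn_small; last by rewrite ltn_neqAle kN ltn_ord.
by rewrite -(natr1 (k i)) mulrDr mulr1 addrA.
Qed.

Lemma card_nodes : (#|{ffun 'I_n -> 'I_N}|%:R : R) = N%:R ^+ n.
Proof. by rewrite card_ffun !card_ord natrX. Qed.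

Lemma mean_le (F G : 'rV[R]_n -> R) : (forall x, box x -> F x <= G x) ->
  mean F <= mean G.
Proof.
move=> FG; apply: ler_wpM2l; first by rewrite invr_ge0 exprn_ge0.
by apply: ler_sum => k _; apply: FG; exact: node_box.
Qed.

Lemma meanD (F G : 'rV[R]_n -> R) : mean (fun x => F x + G x) = mean F + mean G.
Proof. by rewrite /mean big_split mulrDr. Qed.

Lemma meanZ c (F : 'rV[R]_n -> R) : mean (fun x => c * F x) = c * mean F.
Proof. by rewrite /mean -mulr_sumr mulrCA. Qed.

Lemma mean_sum m (F : 'I_m -> 'rV[R]_n -> R) :
  mean (fun x => \sum_i F i x) = \sum_i mean (F i).
Proof. by rewrite /mean exchange_big mulr_sumr. Qed.

Lemma mean_cst c : mean (fun=> c) = c.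
Proof.
rewrite /mean sumr_const -[c *+ _]mulr_natl card_nodes mulKf //.
by rewrite expf_neq0 // gt_eqF.
Qed.

(** A discrete divergence theorem. The increments of [F] over one lattice step sum to zero by
    [sum_shift], and each equals the step times a value of [G] on the step. Thus [G] sums to zero at
    these intermediate points, and moving back to the nodes costs at most its oscillation over one
    step. *)
Lemma mean_derive_le (F G : 'rV[R]_n -> R) i (eps : R) :
  (forall x, is_derive x (basis_vec R i) F (G x)) ->
  (forall x, box x -> `|x 0 i - x0 0 i| = L -> F x = 0) ->
  (forall x s, 0 <= s <= 2 * L / N%:R -> box x -> box (x + s *: basis_vec R i) ->
     `|G x - G (x + s *: basis_vec R i)| <= eps) ->
  `|mean G| <= eps.
Proof.
move=> dF F0 osc; set d := 2 * L / N%:R.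
have d0 : 0 < d by rewrite divr_gt0 ?mulr_gt0.
have /choice[s sP] k : exists s : R, 0 <= s <= d /\
    F (node k + d *: basis_vec R i) - F (node k) = d * G (node k + s *: basis_vec R i).
  have [s sd E] := mvt_line (ltW d0) (fun s _ => dF (node k + s *: basis_vec R i)).
  by exists s.
have S0 : \sum_k G (node k + s k *: basis_vec R i) = 0.
  apply: (mulfI (x := d)); first by rewrite gt_eqF.
  rewrite mulr0 mulr_sumr -(eq_bigr _ (fun k _ => (sP k).2)) sumrB.
  by rewrite sum_shift // subrr.
rewrite /mean normrM ger0_norm ?invr_ge0 ?exprn_ge0//.
rewrite mulrC ler_pdivrMr ?exprn_gt0// mulrC.
have -> : \sum_k G (node k) = \sum_k (G (node k) - G (node k + s k *: basis_vec R i)).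
  by rewrite sumrB S0 subr0.
apply: le_trans (ler_norm_sum _ _ _) _.
rewrite -card_nodes mulr_natl -sumr_const; apply: ler_sum => k _.
by have [sd _] := sP k; apply: osc => //; [exact: node_box | exact: step_box].
Qed.

End Lattice.

Lemma card_ord_interval (N c p : nat) : (c + p < N)%N ->
  (p < #|[pred k : 'I_N | (c <= k <= c + p)%N]|)%N.
Proof.
move=> cp.
have lt (l : 'I_p.+1) : (c + l < N)%N by rewrite (leq_ltn_trans _ cp) // leq_add2l -ltnS.
pose f (l : 'I_p.+1) : 'I_N := Ordinal (lt l).
have fi : injective f by move=> l m /(congr1 val)/= /addnI/val_inj.
rewrite -[p.+1]card_ord -(card_codom fi); apply/subset_leq_card/fintype.subsetP => k.
by move=> /codomP[l ->]; rewrite inE /= leq_addr leq_add2l -ltnS ltn_ord.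
Qed.

(** With an even number [c.*2] of nodes per axis, [x0] is itself a node, with all indices equal to
    [c]. On each axis the indices from [c] to [c + p] stay within distance [r] of it, and there are
    at least [r / (2 * L) * N] of these. All other nodes contribute nonnegatively. *)
Lemma mean_ge (R : realType) (n : nat) (x0 : 'rV[R]_n) (L r a : R) (c : nat)
    (F : 'rV[R]_n -> R) : 0 < L -> 0 < r <= L / 2 -> (0 < c)%N -> 0 <= a ->
  (forall x, box x0 L x -> 0 <= F x) ->
  (forall x : 'rV[R]_n, (forall i, `|x 0 i - x0 0 i| <= r) -> a <= F x) ->
  (r / (2 * L)) ^+ n * a <= mean x0 L c.*2 F.
Proof.
move=> L0 /andP[r0 rL] c0 a0 F0 Fa.
pose N := c.*2; have N0 : (0 < N)%N by rewrite double_gt0.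
have N0R : (0 : R) < N%:R by rewrite ltr0n.
have c0R : (0 : R) < c%:R by rewrite ltr0n.
pose d := 2 * L / N%:R; have d0 : 0 < d by rewrite divr_gt0 ?mulr_gt0.
have Ec : d * c%:R = L.
  have : (2 : R) != 0 by [].
  have : (c%:R : R) != 0 by rewrite gt_eqF.
  rewrite /d /N -muln2 natrM => h1 h2; field; by rewrite h1.
pose p := Num.truncn (r / d).
have /andP[pr rp] := truncn_itv (ltW (divr_gt0 r0 d0)).
have pd : d * p%:R <= r by rewrite mulrC -ler_pdivlMr.
(* From [d * p <= r <= L / 2 < L = d * c] one gets [p < c], so the indices up to [c + p] do not
   leave the lattice. *)
have pc : (c + p < N)%N.
  rewrite /N -addnn ltn_add2l -(ltr_nat R) -(ltr_pM2l d0) Ec.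
  by rewrite (le_lt_trans pd) // (le_lt_trans rL) // ltr_pdivrMr// ltr_pMr// ltr1n.
pose A := [pred k : 'I_N | (c <= k <= c + p)%N].
have cA : r / (2 * L) * N%:R <= #|A|%:R.
  have -> : r / (2 * L) * N%:R = r / d by rewrite /d invf_div mulrA [LHS]mulrAC.
  by rewrite (le_trans (ltW rp)) // ler_nat card_ord_interval.
rewrite /mean ler_pdivlMl ?exprn_gt0 // -/N.
have nearF (k : {ffun 'I_n -> 'I_N}) : k \in ffun_on A -> a <= F (node x0 L k).
  move=> /ffun_onP kA; apply: Fa => i; rewrite !mxE.
  have := kA i; rewrite inE /= => /andP[ck kp].
  rewrite -/d; have -> : x0 0 i - L + d * (k i)%:R - x0 0 i = d * (k i - c)%:R.
    by rewrite natrB // mulrBr Ec; ring.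
  rewrite ger0_norm; last by rewrite mulr_ge0 // ltW.
  by apply: le_trans pd; rewrite ler_pM2l// ler_nat leq_subLR.
apply: (@le_trans _ _ (\sum_(k : {ffun 'I_n -> 'I_N} | k \in ffun_on A) a)).
  rewrite sumr_const card_ffun_on card_ord -[a *+ _]mulr_natl mulrA ler_wpM2r //.
  rewrite natrX -exprMn mulrC lerXn2r ?nnegrE // mulr_ge0 // ltW //.
  by rewrite divr_gt0 ?mulr_gt0.
rewrite [leRHS](bigID (fun k => k \in ffun_on A)) /= -[leLHS]addr0.
apply: lerD; first by apply: ler_sum => k; exact: nearF.
by apply: sumr_ge0 => k _; apply: F0; exact: node_box.
Qed.

(** * Calculus on the slab *)

Lemma within_continuousM (X : topologicalType) (K : numFieldType) (A : set X) (f g : X -> K) :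
  {within A, continuous f} -> {within A, continuous g} ->
  {within A, continuous (fun x => f x * g x)}.
Proof.
move=> /subspace_continuousP cf /subspace_continuousP cg.
apply/subspace_continuousP => x Ax; apply: cvgM; [exact: cf|exact: cg].
Qed.

Lemma within_continuous_cst (X Y : topologicalType) (A : set X) (y : Y) :
  {within A, continuous (fun _ : X => y)}.
Proof. by apply/subspace_continuousP => x Ax; exact: cvg_cst. Qed.

Section SlabCalculus.
Variables (R : realType) (n : nat) (T : R).
Hypothesis T0 : 0 < T.
Implicit Types (f g : 'rV[R]_n -> R -> R) (x : 'rV[R]_n) (t : R).

(** As [T > 0], there is room of at least [T / 2] on one side of [t]: after it if [t <= T / 2],
    before it otherwise. Properness is what makes the limit in [dtime] unique. *)
Lemma time_filter_proper t : 0 <= t <= T -> ProperFilter (time_filter T t).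
Proof.
move=> /andP[t0 tT]; apply: Build_ProperFilter_ex => P.
rewrite /time_filter /within /= /dnbhs /within /= => /nbhs_ballP[e /= e0 eP].
pose m := Num.min e T / 2.
have m0 : 0 < m by rewrite divr_gt0// lt_min e0.
have me : m < e by rewrite ltr_pdivrMr// gt_min ltr_pMr// ltr1n.
have mT : m <= T / 2 by rewrite ler_pM2r// ge_min lexx orbT.
have [h|h] := leP t (T / 2).
  exists (t + m); apply: eP; rewrite /= ?/ball /=.
  - by rewrite opprD addNKr normrN gtr0_norm.
  - by rewrite -subr_eq0 addrAC subrr add0r gt_eqF.
  - by rewrite in_itv /=; apply/andP; split; lra.
exists (t - m); apply: eP; rewrite /= ?/ball /=.
- by rewrite opprB addrC subrK gtr0_norm.
- by rewrite -subr_eq0 addrAC subrr add0r oppr_eq0 gt_eqF.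
- by rewrite in_itv /=; apply/andP; split; lra.
Qed.

Lemma dtime_cvg f x t : dtime_exists T f x t ->
  time_quotient f x t @ time_filter T t --> dtime T f x t.
Proof. by []. Qed.

Lemma dtimeE f x t (l : R) : 0 <= t <= T ->
  time_quotient f x t @ time_filter T t --> l ->
  dtime_exists T f x t /\ dtime T f x t = l.
Proof.
move=> tT cl; have FF := time_filter_proper tT; split; first by apply/cvg_ex; exists l.
exact: cvg_lim.
Qed.

Lemma time_quotient_eq f g x t : 0 <= t <= T ->
  (forall s, 0 <= s <= T -> f x s = g x s) ->
  time_quotient f x t @ time_filter T t = time_quotient g x t @ time_filter T t.
Proof.
move=> tT fg; have FF := time_filter_proper tT.
have E : \forall s \near time_filter T t, time_quotient f x t s = time_quotient g x t s.
  rewrite /time_filter near_withinE; apply: nearW => s; rewrite /= in_itv /= => sT.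
  by rewrite /time_quotient !fg.
by rewrite eqEsubset; split; apply: near_eq_cvg; apply: filterS E => s ->.
Qed.

(** Functions are total, but formulas for their derivatives hold only at times in [[0, T]].
    Replacing one function by another in a smoothness statement is legitimate because time quotients
    are also tested only inside [[0, T]]. *)
Lemma Ck_slab_ext k f g : (forall x t, 0 <= t <= T -> f x t = g x t) ->
  Ck_slab T k f -> Ck_slab T k g.
Proof.
elim: k f g => [|k IH] f g fg [cf Cf].
  split=> //; apply: subspace_eq_continuous cf => -[x t] /=.
  by rewrite inE; exact: fg.
have fgt t : 0 <= t <= T -> f^~ t = g^~ t by move=> tT; apply/funext => x; exact: fg.
split.
  apply: subspace_eq_continuous cf => -[x t] /=.
  by rewrite inE; exact: fg.
case: Cf => ds [de dt]; split; [move=> i; have [d1 d2] := ds i; split|split].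
- by move=> x t tT; rewrite -(fgt t tT); exact: d1.
- by apply: IH d2 => x t tT; rewrite /dspace (fgt t tT).
- by move=> x t tT; rewrite /dtime_exists -(time_quotient_eq (f:=f)) //; [exact: de|exact: fg].
- apply: IH dt => x t tT; rewrite /dtime; congr lim.
  by apply: time_quotient_eq => // s; exact: fg.
Qed.

Lemma Ck_slab_lin k f g (a : R) : Ck_slab T k f -> Ck_slab T k g ->
  Ck_slab T k (fun x t => f x t + a * g x t).
Proof.
elim: k f g => [|k IH] f g [cf Cf] [cg Cg].
  split=> //; apply: within_continuousD => //.
  by apply: within_continuousM => //; exact: within_continuous_cst.
split.
  apply: within_continuousD => //.
  by apply: within_continuousM => //; exact: within_continuous_cst.
case: Cf => fs [fe ft]; case: Cg => gs [ge gt].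
have dl i x t : 0 <= t <= T -> is_derive x (basis_vec R i)
    (fun y => f y t + a * g y t) (dspace i f x t + a * dspace i g x t).
  move=> tT; have /derivableP df := (fs i).1 x t tT.
  have /derivableP dg := (gs i).1 x t tT.
  exact: (is_deriveD df (is_deriveZ a dg)).
have dtl x t : 0 <= t <= T ->
    time_quotient (fun x t => f x t + a * g x t) x t @ time_filter T t -->
    dtime T f x t + a * dtime T g x t.
  move=> tT; have FF := time_filter_proper tT.
  have -> : time_quotient (fun x t => f x t + a * g x t) x t =
    (fun s => time_quotient f x t s + a * time_quotient g x t s).
    by apply/funext => s; rewrite /time_quotient; ring.
  apply: cvgD; first exact: dtime_cvg (fe _ _ tT).
  by apply: cvgMl_tmp; exact: dtime_cvg (ge _ _ tT).
split; [move=> i; split|split].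
- by move=> x t tT; have [] := dl i x t tT.
- apply: Ck_slab_ext (IH _ _ (fs i).2 (gs i).2) => x t tT.
  by have [_ <-] := dl i x t tT.
- by move=> x t tT; have [] := dtimeE tT (dtl x t tT).
- apply: Ck_slab_ext (IH _ _ ft gt) => x t tT.
  by have [_ ->] := dtimeE tT (dtl x t tT).
Qed.

(** At an interior time, increments smaller than both [t] and [T - t] stay in the interval, so the
    constrained quotient is eventually the ordinary one. *)
Lemma is_derive_time f x t : 0 < t < T -> dtime_exists T f x t ->
  is_derive t 1 (f x) (dtime T f x t).
Proof.
move=> /andP[t0 tT] /dtime_cvg c.
suff c' : (fun h : R => h^-1 *: ((f x \o shift t) (h *: (1 : R)) - f x t)) @ 0^' --> dtime T f x t.
  by apply: DeriveDef; [apply/cvg_ex; exists (dtime T f x t)|exact: cvg_lim].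
move=> P /c; rewrite /time_filter /nbhs /= /within /= /dnbhs /within /=.
move=> /nbhs_ballP[e /= e0 eP].
apply/nbhs_ballP; exists (Num.min e (Num.min t (T - t))) => /=.
  by rewrite !lt_min e0 t0 subr_gt0.
move=> h; rewrite /ball /= sub0r normrN !lt_min => /and3P[he ht hT] h0.
have := eP (h + t); rewrite /time_quotient /ball /= addrK [h *: 1]mulr1; apply.
- by rewrite opprD addrCA subrr addr0 normrN.
- by rewrite -subr_eq0 addrK.
- move: ht hT; rewrite in_itv /= !ltr_norml => /andP[a b] /andP[c1 d1].
  by apply/andP; split; lra.
Qed.

Lemma mvt_time f x t (d : R) : 0 <= d -> 0 < t -> t + d < T ->
  (forall s, 0 <= s <= T -> dtime_exists T f x s) ->
  exists2 s, t <= s <= t + d & f x (t + d) - f x t = d * dtime T f x s.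
Proof.
move=> d0 t0 tdT de.
have D s : s \in `[t, t + d] -> is_derive s 1 (f x) (dtime T f x s).
  rewrite in_itv /= => /andP[ts sd]; apply: is_derive_time.
    by apply/andP; split; lra.
  by apply: de; apply/andP; split; lra.
have D' s : s \in `]t, t + d[ -> is_derive s 1 (f x) (dtime T f x s).
  by move=> /subset_itv_oo_cc; exact: D.
have cf : {within `[t, t + d], continuous (f x)}.
  by apply: derivable_within_continuous => s /D [].
have td : t <= t + d by rewrite lerDl.
have [s sd E] := MVT_segment td D' cf.
by exists s; [move: sd; rewrite in_itv|rewrite E addrAC subrr add0r mulrC].
Qed.

Lemma within_slab_near_line f x v t (eps : R) :
  {within slab T, continuous (fun p : 'rV[R]_n * R => f p.1 p.2)} ->
  0 <= t <= T -> 0 < eps ->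
  exists2 d, 0 < d & forall r s, `|r| < d -> `|s| < d -> 0 <= t + s <= T ->
    `|f x t - f (x + r *: v) (t + s)| < eps.
Proof.
move=> /subspace_continuousP cf tT e0.
have /cvgr_dist_lt/(_ eps e0) := cf (x, t) tT; rewrite near_withinE => nG0.
have nG : \forall p \near (x, t), slab T p -> `|f x t - f p.1 p.2| < eps by exact: nG0.
have c1 : (fun q : R * R => x + q.1 *: v) @ nbhs (0 : R, 0 : R) --> x + (0:R) *: v.
  apply: (@cvgD R 'rV[R]_n (R * R)%type); first exact: cvg_cst.
  apply: (@cvgZ R 'rV[R]_n (R * R)%type); first exact: cvg_fst.
  exact: cvg_cst.
have c2 : (fun q : R * R => t + q.2) @ nbhs (0 : R, 0 : R) --> t + 0.
  by apply: cvgD; [exact: cvg_cst|exact: cvg_snd].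
rewrite scale0r addr0 in c1; rewrite addr0 in c2.
have cf' : (fun q : R * R => (x + q.1 *: v, t + q.2)) @ nbhs (0 : R, 0 : R) --> (nbhs x, nbhs t).
  by apply: cvg_pair; [exact: c1|exact: c2].
have /nbhs_ballP[d /= d0 dP] := cf' _ nG.
exists d => // r s rd sd ts; apply: (dP (r, s)) => //.
by split; rewrite /ball /= sub0r normrN.
Qed.

(** Schwarz's theorem. The mixed second difference of [f] over a step [d] in space and time is
    [d ^+ 2] times a value of either mixed derivative near [(x, t)]. If the two differed at
    [(x, t)], continuity would keep them apart at all nearby points. *)
Lemma dtime_dspace f i x t : Ck_slab T 2 f -> 0 < t < T ->
  dtime T (dspace i f) x t = dspace i (dtime T f) x t.
Proof.
move=> [_ [fs [fe [ct ts]]]] /andP[t0 tT].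
have [fd [_ [_ [fie [cit _]]]]] := fs i.
have [ftd [cti _]] := ts.1 i.
set a := dtime T (dspace i f); set b := dspace i (dtime T f).
have tT' : 0 <= t <= T by rewrite !ltW.
have alg (y z u v : R) : (y - z) - (u - v) = (y - u) - (z - v) by ring.
apply/eqP; apply: contraT => ab.
have [e e0 eE] : exists2 e, 0 < e & `|a x t - b x t| = e + e.
  exists (`|a x t - b x t| / 2); last exact: splitr.
  by rewrite divr_gt0// normr_gt0 subr_eq0.
have [d1 d10 d1P] := within_slab_near_line x (basis_vec R i) cit tT' e0.
have [d2 d20 d2P] := within_slab_near_line x (basis_vec R i) cti tT' e0.
have [d d0 /and3P[dd1 dd2 dT]] : exists2 d, 0 < d & [&& d < d1, d < d2 & d < T - t].
  have m0 : 0 < Num.min (Num.min d1 d2) (T - t) by rewrite !lt_min d10 d20 subr_gt0.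
  exists (Num.min (Num.min d1 d2) (T - t) / 2); first by rewrite divr_gt0.
  have : Num.min (Num.min d1 d2) (T - t) / 2 < Num.min (Num.min d1 d2) (T - t).
    by rewrite ltr_pdivrMr// ltr_pMr// ltr1n.
  by rewrite [in X in X -> _]lt_min lt_min => /andP[/andP[-> ->] ->].
have tdT : t + d < T by rewrite addrC -ltrBrDr.
have inT s : t <= s <= t + d -> 0 <= s <= T.
  move=> /andP[s1 s2]; rewrite (le_trans (ltW t0) s1) /=.
  exact: le_trans s2 (ltW tdT).
have tdT' : 0 <= t + d <= T by apply: inT; rewrite lerDl lexx ltW.
have near0 s : t <= s <= t + d -> `|s - t| <= d.
  by move=> /andP[s1 s2]; rewrite ger0_norm ?subr_ge0 // lerBlDl.
(* First order of differences: the mean value theorem in space for the time increment of [f], then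
   in time for [dspace i f]. *)
have [r /andP[r0 rd] Er] := mvt_line (f := fun y => f y (t + d) - f y t)
  (g := fun y => dspace i f y (t + d) - dspace i f y t) (x := x) (v := basis_vec R i)
  (ltW d0) (fun s _ => is_deriveB (derivableP (fd (x + s *: basis_vec R i) (t + d) tdT'))
      (derivableP (fd (x + s *: basis_vec R i) t tT'))).
have [s sd Es] := mvt_time (f := dspace i f) (x := x + r *: basis_vec R i) (ltW d0) t0 tdT
   (fun s sT => fie _ s sT).
(* Second order of differences: the space increment [F] is differentiated in time first, and the
   mean value theorem in space then applies to [dtime T f]. *)
pose F y u := f (y + d *: basis_vec R i) u - f y u.
have HF u : 0 <= u <= T -> time_quotient F x u @ time_filter T u -->
    dtime T f (x + d *: basis_vec R i) u - dtime T f x u.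
  move=> uT; have FF := time_filter_proper uT.
  have -> : time_quotient F x u = (fun s => time_quotient f (x + d *: basis_vec R i) u s - time_quotient f x u s).
    by apply/funext => z; rewrite /time_quotient -mulrBr alg.
  by apply: cvgB; [exact: dtime_cvg (fe _ _ uT)|exact: dtime_cvg (fe _ _ uT)].
have [s' sd' Es'] := mvt_time (ltW d0) t0 tdT
   (fun s sT => (dtimeE sT (HF s sT)).1).
have sT' := inT s' sd'.
rewrite (dtimeE sT' (HF s' sT')).2 in Es'.
have [r' /andP[r0' rd'] Er'] := mvt_line (f := fun y => dtime T f y s')
  (g := fun y => b y s') (x := x) (v := basis_vec R i)
  (ltW d0) (fun s _ => derivableP (ftd (x + s *: basis_vec R i) s' sT')).
have E : a (x + r *: basis_vec R i) s = b (x + r' *: basis_vec R i) s'.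
  apply: (mulfI (lt0r_neq0 d0)); apply: (mulfI (lt0r_neq0 d0)).
  have Ea := etrans Er (congr1 ( *%R d) Es).
  have Eb := etrans Es' (congr1 ( *%R d) Er').
  exact: etrans (esym Ea) (etrans (alg _ _ _ _) Eb).
have hA : `|a x t - a (x + r *: basis_vec R i) s| < e.
  have := d1P r (s - t); rewrite subrKC; apply; last exact: inT.
    by rewrite (ger0_norm r0); exact: le_lt_trans rd dd1.
  exact: le_lt_trans (near0 s sd) dd1.
have hB : `|b x t - b (x + r' *: basis_vec R i) s'| < e.
  have := d2P r' (s' - t); rewrite subrKC; apply; last exact: inT.
    by rewrite (ger0_norm r0'); exact: le_lt_trans rd' dd2.
  exact: le_lt_trans (near0 s' sd') dd2.
have : `|a x t - b x t| < e + e.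
  apply: le_lt_trans (ler_distD (a (x + r *: basis_vec R i) s) _ _) _.
  by apply: ltrD; [exact: hA|rewrite E distrC; exact: hB].
by rewrite eE ltxx.
Qed.

End SlabCalculus.

(** * Weights and the algebraic energy inequality *)

Section PointwiseDerive.
Variables (R : realType) (V : normedModType R).
Implicit Types (f g : V -> R) (x v : V).

Lemma is_derive_mul f g x v (df dg : R) :
  is_derive x v f df -> is_derive x v g dg ->
  is_derive x v (fun y => f y * g y) (df * g x + f x * dg).
Proof.
move=> hf hg; apply: (@is_derive_eq _ _ _ (f * g) _ _ _ _ (is_deriveM hf hg)).
by rewrite /GRing.scale /= addrC (mulrC (g x)).
Qed.

Lemma is_derive_add f g x v (df dg : R) :
  is_derive x v f df -> is_derive x v g dg ->
  is_derive x v (fun y => f y + g y) (df + dg).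
Proof. by move=> hf hg; exact: (is_deriveD hf hg). Qed.

Lemma is_derive_scale f x v (c df : R) :
  is_derive x v f df -> is_derive x v (fun y => c * f y) (c * df).
Proof. by move=> hf; exact: (is_deriveZ c hf). Qed.

Lemma is_derive_exp f k x v (df : R) : is_derive x v f df ->
  is_derive x v (fun y => f y ^+ k.+1) (k.+1%:R * f x ^+ k * df).
Proof.
move=> hf; have -> : (fun y => f y ^+ k.+1) = f ^+ k.+1 by rewrite exprfctE.
exact: is_derive_eq (is_deriveX k.+1 hf) _.
Qed.

End PointwiseDerive.

Section Weight.
Variables (R : realType) (n : nat) (x0 : 'rV[R]_n) (L : R).
Hypothesis L0 : 0 < L.
Implicit Types (x v : 'rV[R]_n) (i : 'I_n).

Lemma is_derive_affine (f : 'rV[R]_n -> R) x v (c : R) :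
  (forall h, f (h *: v + x) = f x + c * h) -> is_derive x v f c.
Proof.
move=> fE.
have c' : (fun h : R => h^-1 *: ((f \o shift x) (h *: v) - f x)) @ 0^' --> c.
  apply: (@cvg_trans _ ((fun _ : R => c) @ 0^')); last exact: cvg_cst.
  apply: near_eq_cvg; near=> h.
  rewrite /= fE addrAC subrr add0r /GRing.scale /= mulrCA mulVf ?mulr1 //.
  by near: h; exact: nbhs_dnbhs_neq.
by apply: DeriveDef; [apply/cvg_ex; exists c|exact: cvg_lim].
Unshelve. all: by end_near. Qed.

Definition cutoff1 (s : R) : R := 1 - (s / L) ^+ 2.

Definition cutoff x : R := \prod_i cutoff1 (x 0 i - x0 0 i).

(** This factor is constant in direction [i], so differentiating [cutoff] along that direction only
    touches the quadratic factor. [dcutoff] and [ddcutoff] are the resulting first and second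
    partial derivatives. *)
Definition cutoff_others i x : R := \prod_(j | j != i) cutoff1 (x 0 j - x0 0 j).

Definition dcutoff i x : R := - 2 / L * ((x 0 i - x0 0 i) / L) * cutoff_others i x.

Definition ddcutoff i x : R := - 2 / L ^+ 2 * cutoff_others i x.

Lemma is_derive_cutoff_others i x : is_derive x (basis_vec R i) (cutoff_others i) 0.
Proof.
apply: is_derive_affine => h; rewrite mul0r addr0; apply: eq_bigr => j ji.
by rewrite !mxE eqxx /= (negbTE ji) mulr0 add0r.
Qed.

Lemma cutoffE i x : cutoff x = cutoff1 (x 0 i - x0 0 i) * cutoff_others i x.
Proof. by rewrite /cutoff (bigD1 i). Qed.

Lemma is_derive_dcutoff i x : is_derive x (basis_vec R i) (dcutoff i) (ddcutoff i x).
Proof.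
have L1 : L != 0 by rewrite gt_eqF.
have d1 : is_derive x (basis_vec R i) (fun y : 'rV[R]_n => - 2 / L * ((y 0 i - x0 0 i) / L))
   (- 2 / L ^+ 2).
  by apply: is_derive_affine => h; rewrite !mxE !eqxx /=; field.
apply: is_derive_eq (is_derive_mul d1 (is_derive_cutoff_others i x)) _.
by rewrite mulr0 addr0.
Qed.

Lemma is_derive_cutoff i x : is_derive x (basis_vec R i) cutoff (dcutoff i x).
Proof.
have L1 : L != 0 by rewrite gt_eqF.
(* The quadratic factor is split as [(1 - y) * (1 + y)], a product of affine functions covered by
   [is_derive_affine]. *)
have d1 : is_derive x (basis_vec R i) (fun y : 'rV[R]_n => 1 + (- 1) * ((y 0 i - x0 0 i) / L)) (- 1 / L).
  by apply: is_derive_affine => h; rewrite !mxE !eqxx /=; field.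
have d2 : is_derive x (basis_vec R i) (fun y : 'rV[R]_n => 1 + ((y 0 i - x0 0 i) / L)) (1 / L).
  by apply: is_derive_affine => h; rewrite !mxE !eqxx /=; field.
have d3 := is_derive_mul (is_derive_mul d1 d2) (is_derive_cutoff_others i x).
have -> : cutoff = fun y => (1 + (- 1) * ((y 0 i - x0 0 i) / L)) * (1 + ((y 0 i - x0 0 i) / L)) * cutoff_others i y.
  by apply/funext => y; rewrite (cutoffE i) /cutoff1; congr (_ * _); ring.
by apply: is_derive_eq d3 _; rewrite /dcutoff; field.
Qed.

Lemma cutoff1_bound (s : R) : `|s| <= L -> 0 <= cutoff1 s <= 1.
Proof.
move=> sL; have : 0 <= (s / L) ^+ 2 <= 1.
  rewrite sqr_ge0 /= -(ger0_norm (sqr_ge0 _)) normrX exprn_ile1 //.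
  by rewrite normrM normfV (gtr0_norm L0) ler_pdivrMr // mul1r.
by rewrite /cutoff1 => /andP[a b]; apply/andP; split; lra.
Qed.

Lemma prod_bound (I : finType) (P : pred I) (F : I -> R) :
  (forall k, 0 <= F k <= 1) -> 0 <= \prod_(k | P k) F k <= 1.
Proof.
move=> F01; elim/big_ind : _ => [|a b /andP[a0 a1] /andP[b0 b1]|k _]; rewrite ?F01 //.
  by rewrite ler01 lexx.
by rewrite mulr_ge0 // mulr_ile1.
Qed.

Lemma cutoff_bound x : box x0 L x -> 0 <= cutoff x <= 1.
Proof. by move=> bx; apply: prod_bound => i; exact: cutoff1_bound. Qed.

Lemma cutoff_others_bound i x : box x0 L x -> 0 <= cutoff_others i x <= 1.
Proof. by move=> bx; apply: prod_bound => j; exact: cutoff1_bound. Qed.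

(** The factor [L] makes the bound scale free; this is why the constants of the energy inequality do
    not depend on [L]. *)
Lemma dcutoff_bound i x : box x0 L x -> `|L * dcutoff i x| <= 2.
Proof.
move=> bx; have /andP[c0 c1] := cutoff_others_bound i bx.
have -> : L * dcutoff i x = - 2 * (((x 0 i - x0 0 i) / L) * cutoff_others i x).
  by rewrite /dcutoff; field; rewrite gt_eqF.
rewrite normrM normrN normr_nat -[leRHS]mulr1 ler_pM2l // normrM mulr_ile1 //.
  by rewrite normrM normfV (gtr0_norm L0) ler_pdivrMr // mul1r.
by rewrite ger0_norm.
Qed.

Lemma ddcutoff_bound i x : box x0 L x -> `|L ^+ 2 * ddcutoff i x| <= 2.
Proof.
move=> bx; have /andP[c0 c1] := cutoff_others_bound i bx.
have -> : L ^+ 2 * ddcutoff i x = - 2 * cutoff_others i x.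
  by rewrite /ddcutoff; field; rewrite gt_eqF.
by rewrite normrM normrN normr_nat -[leRHS]mulr1 ler_pM2l // ger0_norm.
Qed.

Lemma cutoff_face i x : `|x 0 i - x0 0 i| = L -> cutoff x = 0.
Proof.
move=> xL; rewrite (cutoffE i) /cutoff1 -(ger0_norm (sqr_ge0 _)) normrX normrM xL.
by rewrite normfV (gtr0_norm L0) divff ?gt_eqF // expr1n subrr mul0r.
Qed.

(** On the half-size box each factor is at least [1 - 1/4], hence at least [1/2]. *)
Lemma cutoff_ge x : (forall i, `|x 0 i - x0 0 i| <= L / 2) -> 2^-1 ^+ n <= cutoff x.
Proof.
move=> xL; rewrite /cutoff -[in leLHS](card_ord n) -prodr_const.
apply: ler_prod => i _; rewrite invr_ge0 ler0n /=.
have h : `|(x 0 i - x0 0 i) / L| <= 2^-1.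
  by rewrite normrM normfV (gtr0_norm L0) ler_pdivrMr // mulrC.
have : ((x 0 i - x0 0 i) / L) ^+ 2 <= 2^-1 ^+ 2.
  by rewrite -(ger0_norm (sqr_ge0 _)) normrX lerXn2r ?nnegrE.
by rewrite /cutoff1 => h2; lra.
Qed.

Lemma cutoff1_coord_continuous j : continuous (fun x : 'rV[R]_n => cutoff1 (x 0 j - x0 0 j)).
Proof.
have c : continuous (fun y : 'rV[R]_n => (y 0 j - x0 0 j) / L).
  move=> x; apply: (@cvgM R 'rV[R]_n (nbhs x)); last exact: cvg_cst.
  by apply: (@cvgB R R 'rV[R]_n (nbhs x)); [exact: (@coord_continuous R 1 n 0 j x)|exact: cvg_cst].
move=> x; apply: (@cvgB R R 'rV[R]_n (nbhs x)); first exact: cvg_cst.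
by apply: (@cvgM R 'rV[R]_n (nbhs x)); exact: c.
Qed.

Lemma prod_cutoff1_continuous (P : pred 'I_n) :
  continuous (fun x : 'rV[R]_n => \prod_(j | P j) cutoff1 (x 0 j - x0 0 j)).
Proof.
elim: (index_enum 'I_n) => [|j s IH].
  rewrite (_ : (fun x => _) = cst 1); first exact: cst_continuous.
  by apply/funext => x; rewrite big_nil.
have [Pj|Pj] := boolP (P j); last first.
  rewrite (_ : (fun x => _) = (fun x : 'rV[R]_n => \prod_(j <- s | P j) cutoff1 (x 0 j - x0 0 j))) //.
  by apply/funext => x; rewrite big_cons (negbTE Pj).
rewrite (_ : (fun x => _) = (fun x : 'rV[R]_n => cutoff1 (x 0 j - x0 0 j) *
    \prod_(j <- s | P j) cutoff1 (x 0 j - x0 0 j))).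
  by move=> x; apply: (@cvgM R 'rV[R]_n (nbhs x)); [exact: cutoff1_coord_continuous|exact: IH].
by apply/funext => x; rewrite big_cons Pj.
Qed.

Lemma cutoff_continuous : continuous cutoff.
Proof. exact: prod_cutoff1_continuous. Qed.

Lemma dcutoff_continuous i : continuous (dcutoff i).
Proof.
move=> x; apply: (@cvgM R 'rV[R]_n (nbhs x)); last exact: prod_cutoff1_continuous.
apply: (@cvgM R 'rV[R]_n (nbhs x)); first exact: cvg_cst.
apply: (@cvgM R 'rV[R]_n (nbhs x)); last exact: cvg_cst.
by apply: (@cvgB R R 'rV[R]_n (nbhs x)); [exact: (@coord_continuous R 1 n 0 i x)|exact: cvg_cst].
Qed.

Lemma ddcutoff_continuous i : continuous (ddcutoff i).
Proof.
move=> x; apply: (@cvgM R 'rV[R]_n (nbhs x)); last exact: prod_cutoff1_continuous.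
exact: cvg_cst.
Qed.

End Weight.

Section AlgIneq.
Variable R : realFieldType.

(* With [q = m - 4], the variables stand for [X = p^(q/2) p^2 Δh],
   [Y = p^(q/2) p ∂_i h / L], [H = p^(q/2) h / L^2], [u = L ∂_i p],
   [w = L^2 ∂_i^2 p] and [M = m]. *)
Lemma energy_ineq_coord (X Y H u w p M nu K1 : R) :
  `|u| <= 2 -> `|w| <= 2 -> 0 <= p <= 1 -> 4 <= M -> 1 <= nu ->
  K1 = 32 * M ^+ 2 * nu ->
  - X ^+ 2 / nu - (32 * M ^+ 4 * nu + 4 * K1 * M ^+ 2) * H ^+ 2 <=
  4 * M * X * Y * u + 2 * X * H * (M * (M - 1) * u ^+ 2 + M * p * w)
  + 2 * K1 * (Y ^+ 2 + (M - 2) * H * Y * u).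
Proof.
move=> u2 w2 /andP[p0 p1] M4 nu1 K1E.
have nu0 : 0 < nu by lra.
have M0 : 0 < M by lra.
have uu : u ^+ 2 <= 4.
  by move: u2; rewrite ler_norml => /andP[a b]; rewrite expr2; nra.
set c := M * (M - 1) * u ^+ 2 + M * p * w.
have c1 : `|c| <= 4 * M ^+ 2.
  have u0 : 0 <= u ^+ 2 by exact: sqr_ge0.
  have pw : `|p * w| <= 2.
    by rewrite normrM (ger0_norm p0) -[leRHS]mul1r; apply: ler_pM.
  move: pw; rewrite !ler_norml /c => /andP[a b].
  have MM : 0 <= M * (M - 1) by apply: mulr_ge0; lra.
  have h1 : 0 <= M * (M - 1) * u ^+ 2 by exact: mulr_ge0.
  have h2 : M * (M - 1) * u ^+ 2 <= M * (M - 1) * 4 by rewrite ler_wpM2l.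
  have h3 : M * (p * w) <= M * 2 by rewrite ler_pM2l.
  have h4 : M * (- 2) <= M * (p * w) by rewrite ler_pM2l.
  have h5 : M * (M - 1) * 4 = 4 * M ^+ 2 - 4 * M by ring.
  have h6 : M <= M ^+ 2 by rewrite expr2 ler_pMr //; lra.
  have -> : M * p * w = M * (p * w) by ring.
  by apply/andP; split; lra.
have cc : c ^+ 2 <= 16 * M ^+ 4.
  have -> : 16 * M ^+ 4 = (4 * M ^+ 2) ^+ 2 by ring.
  by rewrite -(ger0_norm (sqr_ge0 c)) normrX lerXn2r ?nnegrE // mulr_ge0 // sqr_ge0.
(* Half of [X ^+ 2 / nu] and [K1 * Y ^+ 2] absorb the cross term in [X * Y]; the remainder of the
   completed square has the sign of [4 - u ^+ 2]. *)
have e1 : 0 <= X ^+ 2 / (2 * nu) + 32 * M ^+ 2 * nu * Y ^+ 2 + 4 * M * X * Y * u.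
  have -> : X ^+ 2 / (2 * nu) + 32 * M ^+ 2 * nu * Y ^+ 2 + 4 * M * X * Y * u =
    (X + 4 * M * nu * Y * u) ^+ 2 / (2 * nu) + 8 * M ^+ 2 * nu * (4 - u ^+ 2) * Y ^+ 2.
    by field; rewrite gt_eqF.
  apply: addr_ge0; first by apply: divr_ge0; [exact: sqr_ge0|lra].
  apply: mulr_ge0; last exact: sqr_ge0.
  apply: mulr_ge0; last by rewrite subr_ge0.
  by apply: mulr_ge0; [apply: mulr_ge0 => //; exact: sqr_ge0|exact: ltW].
(* The other half of [X ^+ 2 / nu] absorbs the cross term in [X * H], at the price of a multiple of
   [H ^+ 2]; the remainder is controlled by [cc]. *)
have e2 : 0 <= X ^+ 2 / (2 * nu) + 32 * M ^+ 4 * nu * H ^+ 2 + 2 * X * H * c.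
  have -> : X ^+ 2 / (2 * nu) + 32 * M ^+ 4 * nu * H ^+ 2 + 2 * X * H * c =
    (X + 2 * nu * c * H) ^+ 2 / (2 * nu) + 2 * nu * (16 * M ^+ 4 - c ^+ 2) * H ^+ 2.
    by field; rewrite gt_eqF.
  apply: addr_ge0; first by apply: divr_ge0; [exact: sqr_ge0|lra].
  apply: mulr_ge0; last exact: sqr_ge0.
  by apply: mulr_ge0; [lra|rewrite subr_ge0].
(* Of [2 * K1 * Y ^+ 2], one half went into [e1]; the other half absorbs the cross term in
   [H * Y]. *)
have e3 : 0 <= Y ^+ 2 + 2 * (M - 2) * H * Y * u + 4 * M ^+ 2 * H ^+ 2.
  have -> : Y ^+ 2 + 2 * (M - 2) * H * Y * u + 4 * M ^+ 2 * H ^+ 2 =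
    (Y + (M - 2) * u * H) ^+ 2 + (4 * M ^+ 2 - (M - 2) ^+ 2 * u ^+ 2) * H ^+ 2 by ring.
  apply: addr_ge0; first exact: sqr_ge0.
  apply: mulr_ge0; last exact: sqr_ge0.
  rewrite subr_ge0 mulrC; apply: ler_pM => //; try exact: sqr_ge0.
  by rewrite lerXn2r ?nnegrE; lra.
have K10 : 0 <= K1.
  by rewrite K1E; apply: mulr_ge0; [apply: mulr_ge0 => //; exact: sqr_ge0|exact: ltW].
have e3' := mulr_ge0 K10 e3.
have -> : - X ^+ 2 / nu = - (X ^+ 2 / (2 * nu)) - X ^+ 2 / (2 * nu).
  by field; rewrite gt_eqF.
rewrite -K1E in e1; nra.
Qed.

End AlgIneq.

(** * The energy flux *)

Section SmoothSlab.
Variables (R : realType) (n : nat) (T : R).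
Hypothesis T0 : 0 < T.
Implicit Types (f g : 'rV[R]_n -> R -> R) (x : 'rV[R]_n) (t : R).

Definition slab_laplacian f x t : R := laplacian (f^~ t) x.

Lemma smooth_slab_lin f g (a : R) : smooth_slab T f -> smooth_slab T g ->
  smooth_slab T (fun x t => f x t + a * g x t).
Proof. by move=> sf sg k; exact: Ck_slab_lin. Qed.

(** Zero is obtained as [f - f], so its iterated derivatives need no induction of their own. *)
Lemma smooth_slab0 f : smooth_slab T f -> smooth_slab T (fun (_ : 'rV[R]_n) _ => 0).
Proof.
move=> sf k; apply: Ck_slab_ext (smooth_slab_lin (-1) sf sf k) => // x t _.
by rewrite mulN1r subrr.
Qed.

Lemma smooth_slab_dspace i f : smooth_slab T f -> smooth_slab T (dspace i f).
Proof. by move=> sf k; have [_ [/(_ i)[]]] := sf k.+1. Qed.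

Lemma smooth_slab_continuous f : smooth_slab T f ->
  {within slab T, continuous (fun p : 'rV[R]_n * R => f p.1 p.2)}.
Proof. by move=> /(_ 0%N)[]. Qed.

Lemma smooth_slab_is_derive i f x t : smooth_slab T f -> 0 <= t <= T ->
  is_derive x (basis_vec R i) (f^~ t) (dspace i f x t).
Proof. by move=> /(_ 1%N)[_ [/(_ i)[df _] _]] tT; apply: derivableP; exact: df. Qed.

Lemma smooth_slab_dtime_exists f x t : smooth_slab T f -> 0 <= t <= T ->
  dtime_exists T f x t.
Proof. by move=> /(_ 1%N)[_ [_ [de _]]]; exact: de. Qed.

Lemma smooth_slab_sum f (F : 'I_n -> 'rV[R]_n -> R -> R) : smooth_slab T f ->
  (forall i, smooth_slab T (F i)) -> smooth_slab T (fun x t => \sum_i F i x t).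
Proof.
move=> sf sF; elim: (index_enum 'I_n) => [|i s IH] k.
  by apply: Ck_slab_ext (smooth_slab0 sf k) => // x t _; rewrite big_nil.
apply: Ck_slab_ext (smooth_slab_lin 1 (sF i) IH k) => // x t _.
by rewrite big_cons mul1r.
Qed.

Lemma smooth_slab_laplacian f : smooth_slab T f -> smooth_slab T (slab_laplacian f).
Proof.
by move=> sf; apply: (smooth_slab_sum sf) => i; do 2!apply: smooth_slab_dspace.
Qed.

Definition slab_continuous f : Prop :=
  {within slab T, continuous (fun p : 'rV[R]_n * R => f p.1 p.2)}.

Lemma slab_continuousD f g : slab_continuous f -> slab_continuous g ->
  slab_continuous (fun x t => f x t + g x t).
Proof. exact: within_continuousD. Qed.

Lemma slab_continuousM f g : slab_continuous f -> slab_continuous g ->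
  slab_continuous (fun x t => f x t * g x t).
Proof. exact: within_continuousM. Qed.

Lemma slab_continuous_cst (c : R) : slab_continuous (fun _ _ => c).
Proof. exact: within_continuous_cst. Qed.

Lemma slab_continuous_space (w : 'rV[R]_n -> R) : continuous w ->
  slab_continuous (fun x _ => w x).
Proof.
move=> cw; apply/subspace_continuousP => -[x t] _.
apply: cvg_within_filter; apply: (@cvg_comp _ _ _ fst w _ (nbhs x)); last exact: cw.
exact: cvg_fst.
Qed.

End SmoothSlab.

Section Flux.
Variables (R : realType) (n : nat) (T : R).
Hypothesis T0 : 0 < T.
Variables (x0 : 'rV[R]_n) (L : R).
Hypothesis L0 : 0 < L.
Variables (q : nat) (kappa : R) (h : 'rV[R]_n -> R -> R).
Hypothesis h_smooth : smooth_slab T h.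
Implicit Types (x : 'rV[R]_n) (t : R) (i : 'I_n).

Local Notation p := (cutoff x0 L).
Local Notation dp := (dcutoff x0 L).
Local Notation ddp := (ddcutoff x0 L).
Local Notation g := (slab_laplacian h).

(* Two integrations by parts turn [-2 h p^(q+4) Δg], [g = Δh], into [-2 g Δ(h p^(q+4))];
   the [kappa] term produces the [|∇h|^2 p^(q+2)] that controls the cross terms. *)
Definition flux i x t : R :=
  -2 * (h x t * p x ^+ q.+4 * dspace i g x t
        + -1 * ((dspace i h x t * p x ^+ q.+4
              + h x t * (q.+4%:R * p x ^+ q.+3 * dp i x)) * g x t))
  + 2 * kappa * (h x t * dspace i h x t * p x ^+ q.+2).

(** The derivative of [flux] in direction [i], left exactly as the product rule delivers it, so that
    [is_derive_flux] follows by composing the basic rules. It is simplified only in [flux_ineq]. *)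
Definition dflux i x t : R :=
  -2 * ((dspace i h x t * p x ^+ q.+4 + h x t * (q.+4%:R * p x ^+ q.+3 * dp i x))
          * dspace i g x t
        + h x t * p x ^+ q.+4 * dspace i (dspace i g) x t
        + -1 * ((dspace i (dspace i h) x t * p x ^+ q.+4
              + dspace i h x t * (q.+4%:R * p x ^+ q.+3 * dp i x)
              + (dspace i h x t * (q.+4%:R * p x ^+ q.+3 * dp i x)
                + h x t * (q.+4%:R * (q.+3%:R * p x ^+ q.+2 * dp i x) * dp i x
                   + q.+4%:R * p x ^+ q.+3 * ddp i x))) * g x t
           + (dspace i h x t * p x ^+ q.+4
              + h x t * (q.+4%:R * p x ^+ q.+3 * dp i x)) * dspace i g x t))
  + 2 * kappa * ((dspace i h x t * dspace i h x t + h x t * dspace i (dspace i h) x t) * p x ^+ q.+2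
       + h x t * dspace i h x t * (q.+2%:R * p x ^+ q.+1 * dp i x)).

Lemma is_derive_flux i x t : 0 <= t <= T ->
  is_derive x (basis_vec R i) ((flux i)^~ t) (dflux i x t).
Proof.
move=> tT; have g_smooth := smooth_slab_laplacian T0 h_smooth.
have dh := smooth_slab_is_derive i x h_smooth tT.
have db := smooth_slab_is_derive i x (smooth_slab_dspace i h_smooth) tT.
have dg := smooth_slab_is_derive i x g_smooth tT.
have dG := smooth_slab_is_derive i x (smooth_slab_dspace i g_smooth) tT.
have dP := is_derive_cutoff x0 L0 i x.
have dPi := is_derive_dcutoff x0 L0 i x.
have dphi := is_derive_exp q.+3 dP.
have dphi3 := is_derive_exp q.+2 dP.
have dpsi := is_derive_exp q.+1 dP.
have dphii := is_derive_mul (is_derive_scale q.+4%:R dphi3) dPi.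
have d1 := is_derive_mul (is_derive_mul dh dphi) dG.
have d2 := is_derive_mul (is_derive_add (is_derive_mul db dphi) (is_derive_mul dh dphii)) dg.
have d3 := is_derive_mul (is_derive_mul dh db) dpsi.
exact: is_derive_add (is_derive_scale (-2) (is_derive_add d1 (is_derive_scale (-1) d2)))
   (is_derive_scale (2 * kappa) d3).
Qed.

Lemma flux_face i x t : `|x 0 i - x0 0 i| = L -> flux i x t = 0.
Proof.
move=> xL; rewrite /flux (cutoff_face L0 xL).
by rewrite !expr0n /= !(mulr0, mul0r, addr0).
Qed.

Lemma continuous_dflux i : slab_continuous T (dflux i).
Proof.
have g_smooth := smooth_slab_laplacian T0 h_smooth.
have ch : slab_continuous T h := smooth_slab_continuous h_smooth.
have cb : slab_continuous T (dspace i h) := smooth_slab_continuous (smooth_slab_dspace i h_smooth).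
have cbb : slab_continuous T (dspace i (dspace i h)) :=
  smooth_slab_continuous (smooth_slab_dspace i (smooth_slab_dspace i h_smooth)).
have cg : slab_continuous T g := smooth_slab_continuous g_smooth.
have cG : slab_continuous T (dspace i g) := smooth_slab_continuous (smooth_slab_dspace i g_smooth).
have cGG : slab_continuous T (dspace i (dspace i g)) :=
  smooth_slab_continuous (smooth_slab_dspace i (smooth_slab_dspace i g_smooth)).
have cp k : slab_continuous T (fun x _ => p x ^+ k).
  apply: slab_continuous_space; elim: k => [|k IH]; first exact: cst_continuous.
  under eq_fun do rewrite exprS.
  by move=> x; apply: (@cvgM R 'rV[R]_n (nbhs x)); [exact: cutoff_continuous|exact: IH].
have cdp : slab_continuous T (fun x _ => dp i x) by exact/slab_continuous_space/dcutoff_continuous.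
have cddp : slab_continuous T (fun x _ => ddp i x) by exact/slab_continuous_space/ddcutoff_continuous.
rewrite /dflux; repeat lazymatch goal with
 | |- slab_continuous _ (fun x t => @?a x t + @?b x t) => apply: (@slab_continuousD _ _ _ a b)
 | |- slab_continuous _ (fun x t => @?a x t * @?b x t) => apply: (@slab_continuousM _ _ _ a b)
 | |- slab_continuous _ (fun x t => h x t) => exact: ch
 | |- slab_continuous _ (fun x t => dspace i h x t) => exact: cb
 | |- slab_continuous _ (fun x t => dspace i (dspace i h) x t) => exact: cbb
 | |- slab_continuous _ (fun x t => g x t) => exact: cg
 | |- slab_continuous _ (fun x t => dspace i g x t) => exact: cG
 | |- slab_continuous _ (fun x t => dspace i (dspace i g) x t) => exact: cGG
 | |- slab_continuous _ (fun x t => p x ^+ _) => exact: cp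
 | |- slab_continuous _ (fun x t => dp i x) => exact: cdp
 | |- slab_continuous _ (fun x t => ddp i x) => exact: cddp
 | |- slab_continuous _ (fun x t => ?c) => exact: slab_continuous_cst
end.
Qed.

End Flux.

Section FluxIneq.
Variables (R : realType) (n : nat) (x0 : 'rV[R]_n) (L : R) (r : nat).
Hypothesis L0 : 0 < L.
Implicit Types (h : 'rV[R]_n -> R -> R) (x : 'rV[R]_n) (t : R) (i : 'I_n).

Local Notation q := (r.*2).
Local Notation M := (q.+4%:R : R).
Local Notation nu := (n.+1%:R : R).
(** [grad_const] is the [K1] of [energy_ineq_coord] and [coord_const] its coefficient of [H ^+ 2].
    [energy_const] sums the latter over the coordinates and adds what completes the square of
    [X + grad_const * H]. The exponent [q] is even, so [p^(q/2)] is the power [p x ^+ r]. *)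
Definition grad_const : R := 32 * M ^+ 2 * nu.
Definition coord_const : R := 32 * M ^+ 4 * nu + 4 * grad_const * M ^+ 2.
Definition energy_const : R := grad_const ^+ 2 + n%:R * coord_const.

Local Notation p := (cutoff x0 L).

(** In the divergence of the flux the terms in the third derivatives of [h] cancel. There remain the
    left-hand side, [2 * X ^+ 2 + 2 * grad_const * H * X], and cross terms [tau i] bounded below by
    [energy_ineq_coord]. After summation the surplus is the square of [X + grad_const * H]. *)
Lemma flux_ineq h x t : box x0 L x ->
  -2 * h x t * p x ^+ q.+4 * slab_laplacian (slab_laplacian h) x t <=
  \sum_i dflux x0 L q (grad_const / L ^+ 2) h i x t + energy_const / L ^+ 4 * (h x t ^+ 2 * p x ^+ q).
Proof.
move=> bx; have L1 : L != 0 by rewrite gt_eqF.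
have nu0 : 0 < nu by [].
set g := slab_laplacian h.
pose a := p x ^+ r.
pose X := a * g x t * p x ^+ 2.
pose H := a * h x t / L ^+ 2.
pose Y i := a * dspace i h x t * p x / L.
(* [tau i] gathers the terms containing derivatives of the cutoff, together with the good term
   [2 * grad_const * Y i ^+ 2]. *)
pose tau i := 4 * M * X * Y i * (L * dcutoff x0 L i x)
  + 2 * X * H * (M * (M - 1) * (L * dcutoff x0 L i x) ^+ 2 + M * p x * (L ^+ 2 * ddcutoff x0 L i x))
  + 2 * grad_const * (Y i ^+ 2 + (M - 2) * H * Y i * (L * dcutoff x0 L i x)).
have pq k : p x ^+ (q + k) = a ^+ 2 * p x ^+ k by rewrite /a -exprM muln2 exprD.
have M3 : q.+3%:R = M - 1 by rewrite -(natr1 q.+3) addrK.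
have M2 : q.+2%:R = M - 2 by rewrite -[q.+4]addn2 natrD addrK.
have dE i : dflux x0 L q (grad_const / L ^+ 2) h i x t =
    -2 * h x t * p x ^+ q.+4 * dspace i (dspace i g) x t
    + (2 * g x t * p x ^+ q.+4 + 2 * (grad_const / L ^+ 2) * h x t * p x ^+ q.+2) * dspace i (dspace i h) x t
    + tau i.
  pose u := L * dcutoff x0 L i x; pose w := L ^+ 2 * ddcutoff x0 L i x.
  have hu : dcutoff x0 L i x = u / L by rewrite mulrC mulKf.
  have hw : ddcutoff x0 L i x = w * L^-1 ^+ 2 by rewrite mulrC exprVn mulKf // expf_neq0.
  rewrite /dflux -/g M2 M3 hw hu.
  have -> : p x ^+ q.+4 = a ^+ 2 * p x ^+ 4 by rewrite -pq addn4.
  have -> : p x ^+ q.+3 = a ^+ 2 * p x ^+ 3 by rewrite -pq addn3.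
  have -> : p x ^+ q.+2 = a ^+ 2 * p x ^+ 2 by rewrite -pq addn2.
  have -> : p x ^+ q.+1 = a ^+ 2 * p x by rewrite -[in RHS](expr1 (p x)) -pq addn1.
  rewrite /tau /X /Y /H -/u -/w -!exprVn.
  move: (L^-1) (a) (p x) (g x t) (h x t) (dspace i h x t) (dspace i (dspace i h) x t)
    (dspace i g x t) (dspace i (dspace i g) x t) (M) grad_const u w {hu hw} => *.
  by ring.
have tauP i : - X ^+ 2 / nu - coord_const * H ^+ 2 <= tau i.
  apply: energy_ineq_coord => //.
  - exact: dcutoff_bound.
  - exact: ddcutoff_bound.
  - exact: cutoff_bound.
  - by rewrite (ler_nat _ 4).
  - by rewrite (ler_nat _ 1).
clearbody tau.
have -> : \sum_i dflux x0 L q (grad_const / L ^+ 2) h i x t =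
    -2 * h x t * p x ^+ q.+4 * slab_laplacian g x t
    + (2 * g x t * p x ^+ q.+4 + 2 * (grad_const / L ^+ 2) * h x t * p x ^+ q.+2) * g x t
    + \sum_i tau i.
  rewrite (eq_bigr _ (fun i _ => dE i)) 2!big_split; congr (_ + _ + _).
    by rewrite -mulr_sumr.
  by rewrite -mulr_sumr.
rewrite -!addrA lerDl.
have -> : (2 * g x t * p x ^+ q.+4 + 2 * (grad_const / L ^+ 2) * h x t * p x ^+ q.+2) * g x t
   = 2 * X ^+ 2 + 2 * grad_const * H * X.
  rewrite -(addn4 q) -(addn2 q) !pq /X /H; by field.
have -> : energy_const / L ^+ 4 * (h x t ^+ 2 * p x ^+ q) = energy_const * H ^+ 2.
  rewrite -(addn0 q) pq /H; by field.
have : \sum_(i < n) (- X ^+ 2 / nu - coord_const * H ^+ 2) <= \sum_i tau i by exact: ler_sum.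
rewrite sumr_const card_ord -[_ *+ n]mulr_natl.
(* The choice [nu = n + 1] makes the total loss over [n] coordinates at most one [X ^+ 2], of the
   two available. *)
have : - X ^+ 2 <= n%:R * (- X ^+ 2 / nu).
  rewrite mulrA ler_pdivlMr // mulNr mulrN lerN2 mulrC ler_wpM2l ?sqr_ge0 //.
  by rewrite ler_nat.
rewrite mulrBr => h1 h2.
have h3 : - X ^+ 2 - n%:R * (coord_const * H ^+ 2) <= \sum_i tau i.
  by apply: le_trans h2; rewrite lerD2r.
have h4 : 0 <= (X + grad_const * H) ^+ 2 by exact: sqr_ge0.
rewrite /energy_const.
have -> : (grad_const ^+ 2 + n%:R * coord_const) * H ^+ 2 = grad_const ^+ 2 * H ^+ 2 + n%:R * (coord_const * H ^+ 2) by ring.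
have E : (X + grad_const * H) ^+ 2 = X ^+ 2 + 2 * grad_const * H * X + grad_const ^+ 2 * H ^+ 2 by ring.
move: h3 h4; rewrite E; move: (\sum_i _) (n%:R * _) (grad_const ^+ 2 * _) (2 * grad_const * H * X) (X ^+ 2).
by move=> *; lra.
Qed.

End FluxIneq.

(** * Energy decay *)

Section MeanLimits.
Variables (R : realType) (n : nat) (x0 : 'rV[R]_n) (L : R) (N : nat).

Lemma is_derive_mean (f : 'rV[R]_n -> R -> R) (df : 'rV[R]_n -> R) (t : R) :
  (forall x, is_derive t 1 (f x) (df x)) ->
  is_derive t 1 (fun s => mean x0 L N (f^~ s)) (mean x0 L N df).
Proof.
move=> D; rewrite /mean; apply: is_derive_scale.
elim: (index_enum _) => [|k e IH].
  rewrite big_nil (_ : (fun s => _) = cst 0); first exact: is_derive_cst.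
  by apply/funext => s; rewrite big_nil.
rewrite big_cons (_ : (fun s => _) = (fun s => f (node x0 L k) s + \sum_(k <- e) f (node x0 L k) s)).
  by apply: is_derive_add.
by apply/funext => s; rewrite big_cons.
Qed.

Lemma cvg_mean (F : set_system R) (f : 'rV[R]_n -> R -> R) (l : 'rV[R]_n -> R) :
  Filter F -> (forall x, f x @ F --> l x) ->
  (fun s => mean x0 L N (f^~ s)) @ F --> mean x0 L N l.
Proof.
move=> FF D; rewrite /mean; apply: cvgMl_tmp.
elim: (index_enum _) => [|k e IH].
  rewrite big_nil (_ : (fun s => _) = cst 0); first exact: cvg_cst.
  by apply/funext => s; rewrite big_nil.
rewrite big_cons (_ : (fun s => _) = (fun s => f (node x0 L k) s + \sum_(k <- e) f (node x0 L k) s)).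
  by apply: cvgD.
by apply/funext => s; rewrite big_cons.
Qed.

End MeanLimits.

(** Backward difference quotients at [c] are at least [m], since [E] lies below the line of slope
    [m] to the left of [c] and meets it at [c]. *)
Lemma is_derive_ge_slope (R : realType) (E : R -> R) (c dE m : R) : 0 < c ->
  is_derive c 1 E dE -> E c = m * c -> (forall s, 0 < s < c -> E s <= m * s) -> m <= dE.
Proof.
move=> c0 [dv <-] Ec Es; rewrite leNgt; apply/negP => lt.
have cv : (fun h : R => h^-1 *: ((E \o shift c) (h *: 1) - E c)) @ 0^' --> 'D_1 E c by exact: dv.
have /cvgr_lt/(_ m lt) := cv; rewrite near_withinE.
move=> /nbhs_ballP[e /= e0 eP].
pose d := Num.min e c / 2.
have m0 : 0 < Num.min e c by rewrite lt_min e0.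
have d0 : 0 < d by rewrite divr_gt0.
have : d < Num.min e c by rewrite ltr_pdivrMr// ltr_pMr// ltr1n.
rewrite lt_min => /andP[de dc].
have := eP (- d); rewrite /ball /= sub0r opprK gtr0_norm // oppr_eq0 gt_eqF //.
move=> /(_ de isT); rewrite [- d *: 1]mulr1 /GRing.scale /= Ec invrN.
have {}Es : E (- d + c) <= m * (- d + c) by apply: Es; apply/andP; split; lra.
rewrite mulNr ltNge => /negP; apply.
rewrite -mulrN mulrC ler_pdivlMr //; lra.
Qed.

(** The continuous function [E s / s] attains its maximum on [[0, t]] at some [c]. If [c > 0], the
    slope there gives [E c / c <= dE c <= E c / c / 2 + B], so the maximum is at most [2 * B]; if
    [c = 0], the maximum is 0. *)
Lemma ratio_decay (R : realType) (E dE : R -> R) (t B : R) : 0 < t -> 0 <= B ->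
  (forall s, 0 < s <= t -> is_derive s 1 E (dE s)) ->
  (fun s => E s / s) @ 0^'+ --> 0 ->
  (forall s, 0 < s <= t -> dE s <= E s / (2 * s) + B) ->
  E t <= 2 * B * t.
Proof.
move=> t0 B0 dEE E0 ineq; pose F s := E s / s.
have Fc s : 0 < s <= t -> {for s, continuous F}.
  move=> st; have [s0 _] := andP st.
  have [dv _] := dEE s st.
  apply: (@cvgM R R (nbhs s)); last by apply: cvgV; [rewrite gt_eqF|exact: cvg_id].
  exact/differentiable_continuous/derivable1_diffP.
have cF : {within `[0, t], continuous F}.
  apply/(continuous_within_itvP _ t0); split.
  - by move=> s; rewrite in_itv /= => /andP[s0 st]; apply: Fc; rewrite s0 ltW.
  (* With the convention [0^-1 = 0] the value [F 0] is 0, which is also the limit from the right, so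
     [F] is continuous at 0 as it stands. *)
  - by rewrite /F invr0 mulr0; exact: E0.
  - by apply: cvg_at_left_filter; apply: Fc; rewrite t0 lexx.
have [c + cmax] := EVT_max (ltW t0) cF.
rewrite in_itv /= => /andP[c0 ct].
suff Fcb : F c <= 2 * B.
  rewrite -ler_pdivrMr //; apply: le_trans Fcb; apply: cmax.
  by rewrite in_itv /= lexx ltW.
move: c0; rewrite le_eqVlt => /orP[/eqP <-|c0].
  by rewrite /F invr0 mulr0 mulr_ge0.
have cc : 0 < c <= t by rewrite c0.
have EF : E c = F c * c by rewrite /F divfK // gt_eqF.
have h : F c <= dE c.
  apply: (is_derive_ge_slope c0 (dEE c cc) EF) => s /andP[s0 sc].
  rewrite -ler_pdivrMr //; apply: cmax.
  by rewrite in_itv /= !ltW // (lt_le_trans sc).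
have := le_trans h (ineq c cc); rewrite invfM mulrCA -/(F c) => h2; lra.
Qed.

(** One lattice size serves all times. This matters because [ratio_decay] is applied to the lattice
    energy with [N] fixed and time varying. *)
Lemma mean_derive_small (R : realType) (n : nat) (T : R) (x0 : 'rV[R]_n) (L : R)
    (F G : 'I_n -> 'rV[R]_n -> R -> R) (eps : R) :
  0 < L -> 0 < eps ->
  (forall i x t, 0 <= t <= T -> is_derive x (basis_vec R i) ((F i)^~ t) (G i x t)) ->
  (forall i (x : 'rV[R]_n) t, `|x 0 i - x0 0 i| = L -> F i x t = 0) ->
  (forall i, slab_continuous T (G i)) ->
  exists N0 : nat, forall N, (N0 < N)%N -> forall i t, 0 <= t <= T ->
    `|mean x0 L N ((G i)^~ t)| <= eps.
Proof.
move=> L0 e0 dF F0 cG.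
have /choice[N0 N0P] i : exists N0 : nat, forall N, (N0 < N)%N -> forall t, 0 <= t <= T ->
    `|mean x0 L N ((G i)^~ t)| <= eps.
  have [d d0 dP] := within_slab_unif_line x0 L (basis_vec R i) (cG i) e0.
  exists (Num.truncn (2 * L / d)) => N lN t tT.
  have N0 : (0 < N)%N by apply: leq_ltn_trans lN.
  have Nd : 2 * L / N%:R < d.
    have LN : 2 * L / d < N%:R by rewrite -truncn_lt_nat // divr_ge0 ?mulr_ge0 // ltW.
    by rewrite ltr_pdivrMr ?ltr0n // [ltRHS]mulrC -ltr_pdivrMr.
  apply: (@mean_derive_le R n x0 L L0 N N0 ((F i)^~ t) ((G i)^~ t) i eps).
  - by move=> x; exact: dF.
  - by move=> x _; exact: F0.
  - move=> x s /andP[s0 sN] bx bxs; apply/ltW/dP => //.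
    by rewrite ger0_norm // (le_lt_trans sN).
exists (\max_i N0 i) => N lN i; apply: N0P.
by apply: leq_ltn_trans lN; exact: leq_bigmax.
Qed.

Section EnergyDecay.
Variables (R : realType) (n : nat) (T : R).
Hypothesis T0 : 0 < T.
Variable h : 'rV[R]_n -> R -> R.
Hypothesis h_smooth : smooth_slab T h.
Hypothesis h_flow : forall x t, 0 < t < T ->
  dtime T h x t = - slab_laplacian (slab_laplacian h) x t.
Hypothesis h_init : forall x, h x 0 = 0.
Variable C0 : R.
Hypothesis C00 : 0 <= C0.
Hypothesis h_bound : forall x t, 0 <= t <= T -> t * h x t ^+ 2 <= C0.

(** As [h] vanishes at time 0 and has a one-sided time derivative there, [h / s] converges; hence
    [h ^+ 2 / s], being [(h / s) ^+ 2 * s], tends to 0. *)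
Let sq_rate0 x (c : R) : (fun s => h x s ^+ 2 * c / s) @ 0^'+ --> 0.
Proof.
have c0 : time_quotient h x 0 @ time_filter T 0 --> dtime T h x 0.
  by apply: dtime_cvg; apply: smooth_slab_dtime_exists; rewrite // lexx ltW.
have c1 : time_quotient h x 0 @ 0^'+ --> dtime T h x 0.
  move=> P /c0; rewrite /time_filter /nbhs /= /within /= /dnbhs /within /=.
  move=> /nbhs_ballP[e /= e0 eP].
  apply/nbhs_ballP; exists (Num.min e T) => /=; first by rewrite lt_min e0.
  move=> s; rewrite /ball /= sub0r normrN lt_min => /andP[se sT] s0.
  apply: eP; rewrite /ball /= ?sub0r ?normrN ?gt_eqF //.
  by rewrite in_itv /= ltW //= ltW // (le_lt_trans (ler_norm _)).
have c2 : (fun s : R => s) @ 0^'+ --> (0 : R) by apply: cvg_at_right_filter; exact: cvg_id.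
pose F s := time_quotient h x 0 s * time_quotient h x 0 s * s * c.
have c3 : F @ 0^'+ --> dtime T h x 0 * dtime T h x 0 * 0 * c.
  exact: cvgM (cvgM (cvgM c1 c1) c2) (cvg_cst c).
rewrite mulr0 mul0r in c3.
have E : \forall s \near 0^'+, F s = h x s ^+ 2 * c / s.
  near=> s; have s0 : 0 < s by near: s; exact: nbhs_right_gt.
  by rewrite /F /time_quotient h_init !subr0; field; rewrite gt_eqF.
exact: cvg_trans (near_eq_cvg E) c3.
Unshelve. all: by end_near. Qed.

Variables (x0 : 'rV[R]_n) (L : R) (m : nat).
Hypothesis L0 : 0 < L.
(** With this choice the weight exponent [r.*2 + 4] is [4 * (m + 2)], so both weights are powers of
    [p^4], with exponents [m + 2] and [m + 1], as [young_split] requires. *)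
Let r := (m.+1.*2)%N.
Let A := energy_const R n r / L ^+ 4.

Lemma energy_const_ge0 : 0 <= energy_const R n r.
Proof.
rewrite /energy_const addr_ge0 ?sqr_ge0 // mulr_ge0 // /coord_const addr_ge0 //.
  by rewrite !mulr_ge0 // exprn_ge0.
Qed.

(* A form of Young's inequality for [y^k] and [y^(k+1)], obtained by splitting
   on [y <= 2 t a] rather than by optimising the constant. *)
Lemma young_split (y a t : R) (k : nat) : 0 <= y -> 0 <= a -> 0 < t ->
  a * y ^+ k <= y ^+ k.+1 / (2 * t) + a * (2 * t * a) ^+ k.
Proof.
move=> y0 a0 t0.
have b0 : 0 <= 2 * t * a by rewrite mulr_ge0 // mulr_ge0 // ltW.
have [h1|h1] := leP y (2 * t * a).
  have h2 : a * y ^+ k <= a * (2 * t * a) ^+ k by rewrite ler_wpM2l // lerXn2r ?nnegrE.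
  apply: le_trans h2 _; rewrite lerDr divr_ge0 ?exprn_ge0 //.
  by rewrite mulr_ge0 // ltW.
have h2 : a * y ^+ k <= y ^+ k.+1 / (2 * t).
  rewrite exprS ler_pdivlMr ?mulr_gt0 // mulrAC ler_wpM2r ?exprn_ge0 //.
  by rewrite mulrC ltW.
by apply: le_trans h2 _; rewrite lerDl mulr_ge0 // exprn_ge0.
Qed.

(** [ratio_decay] for the lattice energy. Its derivative is bounded through [flux_ineq]: the
    divergence costs at most [eps] on a fine lattice, and [young_split] divides the term with weight
    [p^q] into [E s / (2 * s)] and a constant. As [A] is of order [L^-4], that constant is of order
    [L^(-4(m+2))]. *)
Lemma energy_decay (eps : R) : 0 < eps -> exists N0 : nat, forall N, (N0 < N)%N ->
  forall t, 0 < t < T ->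
  mean x0 L N (fun x => h x t ^+ 2 * cutoff x0 L x ^+ (r.*2).+4) <=
  2 * (2 * A ^+ 2 * C0 * (2 * T * A) ^+ m + eps) * t.
Proof.
move=> e0; set B := 2 * A ^+ 2 * C0 * _.
have A0 : 0 <= A by rewrite divr_ge0 ?exprn_ge0 ?energy_const_ge0 // ltW.
have B0 : 0 <= B.
  rewrite /B; apply: mulr_ge0.
    by apply: mulr_ge0 => //; apply: mulr_ge0 => //; exact: sqr_ge0.
  by rewrite exprn_ge0 // mulr_ge0 // mulr_ge0 // ltW.
(* Each of the [n] directions gets the share [eps / (n + 1)], which is also meaningful for
   [n = 0]. *)
have en0 : 0 < eps / n.+1%:R by rewrite divr_gt0.
have [N0 N0P] := mean_derive_small L0 en0
  (fun i x t tT => is_derive_flux T0 x0 L0 (r.*2) (grad_const R n r / L ^+ 2) h_smooth i x tT)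
  (fun i x t xL => flux_face L0 (r.*2) (grad_const R n r / L ^+ 2) h t xL)
  (@continuous_dflux R n T T0 x0 L (r.*2) (grad_const R n r / L ^+ 2) h h_smooth).
exists N0 => N lN t /andP[t0 tT].
have Npos : (0 < N)%N by apply: leq_ltn_trans lN.
pose p := cutoff x0 L; pose q := r.*2.
pose E s := mean x0 L N (fun x => h x s ^+ 2 * p x ^+ q.+4).
pose dE s := mean x0 L N (fun x => 2 * h x s * dtime T h x s * p x ^+ q.+4).
apply: (@ratio_decay R E dE) => //.
- by apply: addr_ge0 => //; exact: ltW.
- move=> s /andP[s0 st]; apply: is_derive_mean => x.
  have sT : 0 < s < T by rewrite s0 (le_lt_trans st).
  have sT' : 0 <= s <= T by case/andP: sT => *; rewrite !ltW.
  have dh := is_derive_time sT (smooth_slab_dtime_exists (x := x) h_smooth sT').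
  have d2 := is_derive_mul (is_derive_exp 1 dh) (is_derive_cst (p x ^+ q.+4) s 1).
  by apply: is_derive_eq d2 _; rewrite /= mulr0 addr0 expr1.
- have -> : (fun s => E s / s) =
    (fun s => mean x0 L N (fun x => h x s ^+ 2 * p x ^+ q.+4 / s)).
    by apply/funext => s; rewrite /E mulrC -meanZ; congr mean; apply/funext => x; rewrite mulrC.
  rewrite -[X in _ --> X](mean_cst x0 L Npos 0).
  by apply: cvg_mean => x; exact: sq_rate0.
move=> s /andP[s0 st].
have sT : 0 < s < T by rewrite s0 (le_lt_trans st).
have sT' : 0 <= s <= T by case/andP: sT => *; rewrite !ltW.
have -> : E s / (2 * s) + (B + eps) = eps + mean x0 L N (fun x => h x s ^+ 2 * p x ^+ q.+4 * (2 * s)^-1 + B).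
  rewrite meanD mean_cst //.
  have -> : mean x0 L N (fun x => h x s ^+ 2 * p x ^+ q.+4 * (2 * s)^-1) = E s / (2 * s).
    by rewrite [RHS]mulrC /E -meanZ; congr mean; apply/funext => x; rewrite mulrC.
  by ring.
pose D x := \sum_(i < n) dflux x0 L q (grad_const R n r / L ^+ 2) h i x s.
have hD : mean x0 L N D <= eps.
  rewrite mean_sum; apply: (@le_trans _ _ (\sum_(i < n) eps / n.+1%:R)).
    apply: ler_sum => i _; apply: le_trans (ler_norm _) _.
    exact: N0P.
  rewrite sumr_const card_ord -[_ *+ n]mulr_natl mulrA ler_pdivrMr // mulrC.
  by rewrite ler_wpM2l ?ler_nat // ltW.
apply: le_trans (lerD hD (lexx _)); rewrite -meanD; apply: mean_le => // x bx.
have := flux_ineq r L0 h s bx; rewrite -/q -/p -/(D x) => hf.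
have -> : 2 * h x s * dtime T h x s * p x ^+ q.+4 =
    -2 * h x s * p x ^+ q.+4 * slab_laplacian (slab_laplacian h) x s.
  by rewrite h_flow //; ring.
apply: le_trans hf _; rewrite lerD2l -/A.
have /andP[p0 p1] := cutoff_bound L0 bx.
have hy := young_split m.+1 (exprn_ge0 4 p0) A0 s0.
rewrite -!exprM in hy.
have e1 : (4 * m.+1 = q)%N by rewrite /q /r -!muln2 -mulnA mulnC.
have e2 : (4 * m.+2 = q.+4)%N by rewrite mulnS e1.
rewrite e1 e2 in hy.
have := ler_wpM2l (sqr_ge0 (h x s)) hy.
(* One of the [m + 1] factors [s] is spent on [s * h ^+ 2 <= C0]; the others are bounded by [T], so
   the constant is uniform in time. *)
have hB : h x s ^+ 2 * (A * (2 * s * A) ^+ m.+1) <= B.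
  have -> : h x s ^+ 2 * (A * (2 * s * A) ^+ m.+1) = 2 * A ^+ 2 * (s * h x s ^+ 2) * (2 * s * A) ^+ m.
    by rewrite (exprS (2 * s * A)); ring.
  rewrite /B; apply: ler_pM.
  - apply: mulr_ge0; first by apply: mulr_ge0 => //; exact: sqr_ge0.
    by apply: mulr_ge0; [exact: ltW|exact: sqr_ge0].
  - by rewrite exprn_ge0 // mulr_ge0 // mulr_ge0 // ltW.
  - by rewrite ler_wpM2l ?h_bound // mulr_ge0 // sqr_ge0.
  - have s20 : 0 <= 2 * s by rewrite mulr_ge0 // ltW.
    have T20 : 0 <= 2 * T by rewrite mulr_ge0 // ltW.
    have sT2 : 2 * s <= 2 * T by rewrite ler_wpM2l //; case/andP: sT'.
    have sA : 2 * s * A <= 2 * T * A by apply: ler_wpM2r.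
    by apply: lerXn2r => //; rewrite nnegrE; apply: mulr_ge0.
rewrite mulrDr => h3; rewrite [leLHS]mulrCA; apply: (le_trans h3).
by rewrite mulrA lerD2l.
Qed.

End EnergyDecay.

(** * Vanishing of the flow on growing boxes *)

Section Vanishing.
Variables (R : realType) (n : nat) (T : R).
Hypothesis T0 : 0 < T.
Variable h : 'rV[R]_n -> R -> R.
Hypothesis h_smooth : smooth_slab T h.
Hypothesis h_flow : forall x t, 0 < t < T ->
  dtime T h x t = - slab_laplacian (slab_laplacian h) x t.
Hypothesis h_init : forall x, h x 0 = 0.
Variable C0 : R.
Hypothesis C00 : 0 <= C0.
Hypothesis h_bound : forall x t, 0 <= t <= T -> t * h x t ^+ 2 <= C0.

Lemma sq_lower_near x0 t : 0 <= t <= T -> h x0 t != 0 ->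
  exists r a : R, [/\ 0 < r, 0 < a &
    forall x : 'rV[R]_n, (forall i, `|x 0 i - x0 0 i| <= r) -> a <= h x t ^+ 2].
Proof.
move=> tT h0; have b0 : 0 < `|h x0 t| / 2 by rewrite divr_gt0 // normr_gt0.
have /subspace_continuousP ch := smooth_slab_continuous h_smooth.
have /cvgr_dist_lt/(_ _ b0) := ch (x0, t) tT; rewrite near_withinE.
move=> /nbhs_ballP[e /= e0 eP].
exists (e / 2), ((`|h x0 t| / 2) ^+ 2); split; rewrite ?divr_gt0 ?exprn_gt0 // => x xe.
have /(_ tT)/= hx : slab T (x, t) -> `|h x0 t - h x t| < `|h x0 t| / 2.
  apply: (eP (x, t)); split; last by rewrite /= ; exact: ballxx.
  split=> // i j; rewrite (ord1 i) /ball /= distrC.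
  by rewrite (le_lt_trans (xe j)) // ltr_pdivrMr// ltr_pMr// ltr1n.
rewrite -(ger0_norm (sqr_ge0 (h x t))) normrX lerXn2r ?nnegrE ?(ltW b0) //.
have := ler_distD (h x t) (h x0 t) 0; rewrite !subr0 => h1; lra.
Qed.

(** If [h x0 t] were nonzero, the energy at time [t] would be at least a constant times [L^-n],
    whereas [energy_decay] with [m = n] bounds it by a constant times [L^(-4(n+2))]. Multiplied by
    [L ^+ n.+1], the first grows linearly in [L] and the second stays bounded. *)
Lemma flow_vanishes x0 t : 0 < t < T -> h x0 t = 0.
Proof.
move=> tT; apply/eqP; apply: contraT => h0.
have tT' : 0 <= t <= T by case/andP: tT => *; rewrite !ltW.
have [r [a [r0 a0 ra]]] := sq_lower_near tT' h0.
pose K := energy_const R n (n.+1.*2); pose Q := ((n.+1.*2).*2).+4.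
have K0 : 0 <= K by exact: energy_const_ge0.
(* A lower bound for [h ^+ 2 * p ^+ Q] near [x0]: there [h ^+ 2 >= a], and [p >= 2^-n] by
   [cutoff_ge] once [r <= L / 2]. *)
pose a1 := a * (2^-1 ^+ n) ^+ Q.
have a10 : 0 < a1 by rewrite /a1 mulr_gt0 // !exprn_gt0.
pose D := 2 * (2 * K ^+ 2 * C0 * (2 * T * K) ^+ n) * T.
have main (L : R) : r <= L / 2 -> 1 <= L -> (r / 2) ^+ n * a1 * L <= D.
  move=> rL L1; have L0 : 0 < L by lra.
  have low : (r / (2 * L)) ^+ n * a1 <=
      2 * (2 * (K / L ^+ 4) ^+ 2 * C0 * (2 * T * (K / L ^+ 4)) ^+ n) * t.
    apply/ler_addgt0Pr => e e0.
    (* For fixed [L] the lattice error is arbitrary; with this value it contributes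
       [e * (t / T) <= e]. *)
    have e'0 : 0 < e / (2 * T) by rewrite divr_gt0 // mulr_gt0.
    have [N0 N0P] := energy_decay T0 h_smooth h_flow h_init C00 h_bound x0 n L0 e'0.
    (* [mean_ge] asks for an even number of nodes per axis, hence the double of [N0.+1]. *)
    have lN : (N0 < (N0.+1).*2)%N by rewrite -addnn ltn_addr.
    have := N0P _ lN t tT; rewrite -/K -/Q => up.
    have rL' : 0 < r <= L / 2 by rewrite r0.
    have := @mean_ge R n x0 L r a1 N0.+1 (fun x => h x t ^+ 2 * cutoff x0 L x ^+ Q)
      L0 rL' isT (ltW a10) _ _.
    move=> /(_ _ _)/le_trans; apply.
    - move=> x bx; apply: mulr_ge0; first exact: sqr_ge0.
      by apply: exprn_ge0; case/andP: (cutoff_bound L0 bx).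
    - move=> x xr; apply: ler_pM; rewrite ?(ltW a0) ?exprn_ge0 ?ra //.
      rewrite lerXn2r ?nnegrE ?exprn_ge0 //.
        by apply: le_trans (_ : 2^-1 ^+ n <= _); [rewrite exprn_ge0|apply: cutoff_ge => // i; exact: le_trans (xr i) rL].
      by apply: cutoff_ge => // i; exact: le_trans (xr i) rL.
    apply: le_trans up _; rewrite mulrDr mulrDl lerD2l.
    have -> : 2 * (e / (2 * T)) * t = e * (t / T) by field; rewrite gt_eqF.
    rewrite -[leRHS]mulr1 ler_wpM2l // ?(ltW e0) // ler_pdivrMr // mul1r.
    by case/andP: tT'.
  pose la := (L ^+ 4)^-1.
  have L4 : 1 <= L ^+ 4 by rewrite exprn_ege1.
  have la0 : 0 <= la by rewrite invr_ge0 exprn_ge0 // ltW.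
  have la1 : la <= 1 by rewrite invf_le1 // exprn_gt0.
  have laL : la * L <= 1.
    by rewrite /la mulrC ler_pdivrMr ?exprn_gt0 // mul1r -[leLHS]expr1 ler_weXn2l.
  (* Grouped as [la * (la * L) ^+ n.+1], a product of numbers in [[0, 1]] because [L >= 1]. *)
  have laLn : la ^+ n.+2 * L ^+ n.+1 <= 1.
    rewrite exprS -mulrA -exprMn mulr_ile1 ?exprn_ge0 ?mulr_ge0 ?(ltW L0) //.
    by rewrite exprn_ile1 // mulr_ge0 // ltW.
  have Ln0 : 0 <= L ^+ n.+1 by rewrite exprn_ge0 // ltW.
  have := ler_wpM2r Ln0 low.
  have -> : (r / (2 * L)) ^+ n * a1 * L ^+ n.+1 = (r / 2) ^+ n * a1 * L.
    have -> : r / (2 * L) = r / 2 * L^-1 by rewrite invfM mulrA.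
    have alg (u v w a' l : R) : u * v * a' * (l * w) = u * a' * l * (v * w) by ring.
    by rewrite (exprMn _ (r / 2)) exprS alg -exprMn mulVf ?gt_eqF // expr1n mulr1.
  move=> /le_trans; apply.
  have -> : 2 * (2 * (K / L ^+ 4) ^+ 2 * C0 * (2 * T * (K / L ^+ 4)) ^+ n) * t * L ^+ n.+1
     = 2 * (2 * K ^+ 2 * C0 * (2 * T * K) ^+ n) * (t * (la ^+ n.+2 * L ^+ n.+1)).
    by rewrite -/la (mulrA (2 * T)) !exprMn !exprS; ring.
  apply: ler_wpM2l.
    by do ?[apply: mulr_ge0 | apply: exprn_ge0 | exact: ltW] => //; exact: sqr_ge0.
  have [t0 tT1] := andP tT'; rewrite -[leRHS]mulr1; apply: ler_pM => //.
  by apply: mulr_ge0 => //; exact: exprn_ge0.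
pose b := (r / 2) ^+ n * a1.
have b0 : 0 < b by rewrite mulr_gt0 // exprn_gt0 // divr_gt0.
(* Large enough for [b * L > D], [r <= L / 2] and [L >= 1] at once. *)
pose L := `|D| / b + 2 * r + 1.
have Lb : 0 <= `|D| / b by rewrite divr_ge0 // ltW.
have rL : r <= L / 2 by rewrite /L ler_pdivlMr //; lra.
have L1 : 1 <= L by rewrite /L; lra.
have := main L rL L1; rewrite -/b leNgt => /negP[].
rewrite (le_lt_trans (ler_norm D)) // mulrC -ltr_pdivrMr //.
by rewrite /L; lra.
Qed.

End Vanishing.

(** * Uniqueness *)

Section Uniqueness.
Variables (R : realType) (n : nat) (T : R).
Hypothesis T0 : 0 < T.
Implicit Types (f g w : 'rV[R]_n -> R -> R) (x : 'rV[R]_n) (t : R).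

Lemma dspace_lin i f g (a : R) x t : smooth_slab T f -> smooth_slab T g ->
  0 <= t <= T ->
  dspace i (fun x t => f x t + a * g x t) x t = dspace i f x t + a * dspace i g x t.
Proof.
move=> sf sg tT.
have df := smooth_slab_is_derive i x sf tT.
have dg := smooth_slab_is_derive i x sg tT.
by have [_] := is_derive_add df (is_derive_scale a dg).
Qed.

Lemma dtime_lin f g (a : R) x t : smooth_slab T f -> smooth_slab T g ->
  0 <= t <= T ->
  dtime T (fun x t => f x t + a * g x t) x t = dtime T f x t + a * dtime T g x t.
Proof.
move=> sf sg tT; have FF := time_filter_proper T0 tT; apply: (dtimeE T0 tT _).2.
have -> : time_quotient (fun x t => f x t + a * g x t) x t =
  (fun s => time_quotient f x t s + a * time_quotient g x t s).
  by apply/funext => s; rewrite /time_quotient; ring.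
apply: cvgD; first exact: dtime_cvg (smooth_slab_dtime_exists (x := x) sf tT).
by apply: cvgMl_tmp; exact: dtime_cvg (smooth_slab_dtime_exists (x := x) sg tT).
Qed.

Lemma slab_laplacian_lin f g (a : R) x t : smooth_slab T f -> smooth_slab T g ->
  0 <= t <= T ->
  slab_laplacian (fun x t => f x t + a * g x t) x t =
  slab_laplacian f x t + a * slab_laplacian g x t.
Proof.
move=> sf sg tT; rewrite /slab_laplacian /laplacian mulr_sumr -big_split /=.
apply: eq_bigr => i _.
have -> : 'D_(basis_vec R i) (fun y => f y t + a * g y t) =
    (fun y => dspace i f y t + a * dspace i g y t).
  by apply/funext => y; exact: (dspace_lin i a y sf sg tT).
exact: (dspace_lin i a x (smooth_slab_dspace i sf) (smooth_slab_dspace i sg) tT).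
Qed.

Lemma slab_laplacian_eq f g x t : (forall y, f y t = g y t) ->
  slab_laplacian f x t = slab_laplacian g x t.
Proof. by move=> fg; rewrite /slab_laplacian (_ : f^~ t = g^~ t) //; apply/funext. Qed.

Lemma slab_laplacian0 f x t : (forall y, f y t = 0) -> slab_laplacian f x t = 0.
Proof.
move=> f0; rewrite /slab_laplacian (_ : f^~ t = cst 0); last by apply/funext.
rewrite /laplacian big1 // => i _.
rewrite (_ : 'D_(basis_vec R i) (cst 0) = cst 0); last by apply/funext => y; exact: derive_cst.
exact: derive_cst.
Qed.

Lemma slab_laplacianN f x t : smooth_slab T f -> 0 <= t <= T ->
  slab_laplacian (fun x t => - f x t) x t = - slab_laplacian f x t.
Proof.
move=> sf tT.
rewrite (@slab_laplacian_eq _ (fun x t => 0 + -1 * f x t)); last first.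
  by move=> y; rewrite add0r mulN1r.
rewrite (slab_laplacian_lin _ _ (smooth_slab0 T0 sf) sf tT).
by rewrite slab_laplacian0 // add0r mulN1r.
Qed.

Lemma dtime_sum (F : 'I_n -> 'rV[R]_n -> R -> R) x t :
  (forall i, smooth_slab T (F i)) -> 0 <= t <= T ->
  dtime T (fun x t => \sum_i F i x t) x t = \sum_i dtime T (F i) x t.
Proof.
move=> sF tT; have FF := time_filter_proper T0 tT; apply: (dtimeE T0 tT _).2.
have -> : time_quotient (fun x t => \sum_i F i x t) x t =
  (fun s => \sum_i time_quotient (F i) x t s).
  by apply/funext => s; rewrite /time_quotient -mulr_sumr sumrB.
elim: (index_enum 'I_n) => [|i e IH].
  rewrite big_nil (_ : (fun s => _) = cst 0); first exact: cvg_cst.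
  by apply/funext => s; rewrite big_nil.
rewrite big_cons (_ : (fun s => _) = (fun s => time_quotient (F i) x t s +
    \sum_(j <- e) time_quotient (F j) x t s)).
  by apply: cvgD => //; exact: dtime_cvg (smooth_slab_dtime_exists (x := x) (sF i) tT).
by apply/funext => s; rewrite big_cons.
Qed.

(** [dtime_dspace] is used twice for each direction: first for [dspace i w], then for [w] at all
    points of the time slice. *)
Lemma dtime_laplacian w x t : smooth_slab T w -> 0 < t < T ->
  dtime T (slab_laplacian w) x t = slab_laplacian (dtime T w) x t.
Proof.
move=> sw tT; have tT' : 0 <= t <= T by case/andP: tT => *; rewrite !ltW.
rewrite [LHS](dtime_sum _ (fun i => smooth_slab_dspace i (smooth_slab_dspace i sw)) tT').
apply: eq_bigr => i _.
rewrite (dtime_dspace T0 i x (smooth_slab_dspace i sw 2%N) tT).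
have E : (dtime T (dspace i w))^~ t = (dspace i (dtime T w))^~ t.
  by apply/funext => y; exact: (dtime_dspace T0 i y (sw 2%N) tT).
exact: (congr1 (fun F => 'D_(basis_vec R i) F x) E).
Qed.

(** The mean value theorem only asks for the derivative inside the interval; continuity on the slab
    brings in both end points, [t = T] included. *)
Lemma dtime_eq0_cst f x : smooth_slab T f ->
  (forall t, 0 < t < T -> dtime T f x t = 0) ->
  forall t, 0 <= t <= T -> f x t = f x 0.
Proof.
move=> sf df t /andP[]; rewrite le_eqVlt => /orP[/eqP<- //|t0 tT].
have D s : s \in `]0, t[ -> is_derive s 1 (f x) (cst 0 s).
  rewrite in_itv /= => /andP[s0 st].
  have sT : 0 < s < T by rewrite s0 (lt_le_trans st).
  have sT' : 0 <= s <= T by case/andP: sT => *; rewrite !ltW.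
  rewrite /= -(df s sT); exact: is_derive_time sT (smooth_slab_dtime_exists (x := x) sf sT').
have cf : {within `[0, t], continuous (f x)}.
  have /subspace_continuousP c := smooth_slab_continuous sf.
  apply/subspace_continuousP => s /=; rewrite in_itv /= => /andP[s0 st].
  have sT : 0 <= s <= T by rewrite s0 (le_trans st).
  apply/cvgrPdist_lt => d d0.
  have /cvgr_dist_lt/(_ d d0) := c (x, s) sT; rewrite !near_withinE.
  move=> /nbhs_ballP[e /= e0 eP].
  apply/nbhs_ballP; exists e => //= r sr; rewrite in_itv /= => /andP[r0 rt].
  apply: (eP (x, r)); first by split => //; exact: ballxx.
  by rewrite /slab /= r0 (le_trans rt).
have [c _] := MVT t0 D cf.
by rewrite mul0r => /eqP; rewrite subr_eq0 => /eqP.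
Qed.

End Uniqueness.

Theorem theorem1p3 (R : realType) (n : nat) (T : R) (hT : 0 < T)
    (u v : 'rV[R]_n -> R -> R)
    (u_smooth : smooth_slab T u) (v_smooth : smooth_slab T v)
    (u_flow : biharmonic_heat_flow T u) (v_flow : biharmonic_heat_flow T v)
    (k0 : R)
    (bound : forall (x : 'rV[R]_n) (t : R), 0 <= t <= T ->
       t * (`|laplacian (v^~ t) x| ^+ 2 + `|laplacian (u^~ t) x| ^+ 2) <= k0)
    (initial : forall x : 'rV[R]_n, u x 0 = v x 0) :
  forall (x : 'rV[R]_n) (t : R), 0 <= t <= T -> u x t = v x t.
Proof.
(* The difference is written in the form [f + a * g] of the linearity lemmas. *)
pose w (x : 'rV[R]_n) (t : R) := u x t + -1 * v x t.
have w_smooth : smooth_slab T w by exact: smooth_slab_lin.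
have w_init x : w x 0 = 0 by rewrite /w initial mulN1r subrr.
pose h := slab_laplacian w.
have h_smooth : smooth_slab T h by exact: smooth_slab_laplacian.
have w_flow x t : 0 <= t <= T -> dtime T w x t = - slab_laplacian h x t.
  move=> tT; rewrite (dtime_lin hT (-1) x u_smooth v_smooth tT) u_flow // v_flow //.
  have -> : slab_laplacian h x t = slab_laplacian
      (fun y s => slab_laplacian u y s + -1 * slab_laplacian v y s) x t.
    by apply: slab_laplacian_eq => y; exact: slab_laplacian_lin.
  rewrite (slab_laplacian_lin (-1) x (smooth_slab_laplacian hT u_smooth)
    (smooth_slab_laplacian hT v_smooth) tT).
  by rewrite mulrN opprD.
have h_flow x t : 0 < t < T -> dtime T h x t = - slab_laplacian (slab_laplacian h) x t.
  move=> tT; have tT' : 0 <= t <= T by case/andP: tT => *; rewrite !ltW.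
  rewrite (dtime_laplacian hT x w_smooth tT) (slab_laplacian_eq x (g := fun y s => - slab_laplacian h y s)).
    exact: (slab_laplacianN hT x (smooth_slab_laplacian hT h_smooth) tT').
  by move=> y; exact: w_flow.
have h_init x : h x 0 = 0 by exact: slab_laplacian0.
have k00 : 0 <= 2 * k0.
  (* At [t = 0] the left-hand side of the bound is 0, which shows [0 <= k0]. *)
  have := bound 0 0; rewrite lexx ltW // mul0r => /(_ isT) k0p.
  by rewrite mulr_ge0.
have h_bound x t : 0 <= t <= T -> t * h x t ^+ 2 <= 2 * k0.
  move=> tT; have t0 : 0 <= t by case/andP: tT.
  have -> : h x t = slab_laplacian u x t + -1 * slab_laplacian v x t.
    exact: (slab_laplacian_lin (-1) x u_smooth v_smooth tT).
  have : t * (`|slab_laplacian v x t| ^+ 2 + `|slab_laplacian u x t| ^+ 2) <= k0.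
    exact: bound.
  move: (slab_laplacian u x t) (slab_laplacian v x t) => a b.
  rewrite !real_normK ?num_real // => hb.
  (* By the parallelogram identity, [(a - b)^2] is at most [2 * (a^2 + b^2)]; this is the source of
     the constant [2 * k0]. *)
  have : 0 <= t * (a + b) ^+ 2 by apply: mulr_ge0 => //; exact: sqr_ge0.
  have -> : t * (a + b) ^+ 2 = 2 * (t * (b ^+ 2 + a ^+ 2)) - t * (a + -1 * b) ^+ 2 by ring.
  by move: hb t0; clear; lra.
have h0 x t : 0 < t < T -> h x t = 0.
  exact: (flow_vanishes hT h_smooth h_flow h_init k00 h_bound).
(* With [h = 0] at interior times, the time derivative of [w] vanishes there, so [w] keeps its
   initial value 0 up to and including [T]. *)
move=> x t tT; apply/eqP; rewrite -subr_eq0 -mulN1r -/(w x t) -(w_init x).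
apply/eqP; apply: dtime_eq0_cst tT => // s sT.
have sT' : 0 <= s <= T by case/andP: sT => *; rewrite !ltW.
by rewrite (w_flow x s sT') (slab_laplacian0 x (fun y => h0 y s sT)) oppr0.
Qed.
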